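(* Fix $\tau>0$ and $\mu\in(0,1)$, and for each $N\in\mathbb N$ let $X^N$ be the continuous-time process on $\Omega_N$ defined in the context, with initial condition $X^N_j(0)=\mu N$ for all $j$. Define the rescaled process $$Y^N(t)=\begin{cases}\dfrac{X^N_{-\lfloor\tau N\rfloor}(N(t+\tau))}{N}, & t\in[-\tau,0),\\[2mm] \dfrac{X^N_0(Nt)}{N}, & t\ge 0.\end{cases}$$ Then for every $T>0$ the sequence of processes $\{Y^N(t):t\in[-\tau,T]\}_{N\ge1}$ converges in probability, in the Skorokhod topology of $D([-\tau,T],\mathbb R)$, to the unique continuous solution $u:[-\tau,T]\to\mathbb R$ of the delayed logistic (Hutchinson) equation $$u'(t)=\tfrac12\,u(t)\bigl(1-u(t-\tau)\bigr)\ \ (t>0),\qquad u(t)=\mu\ \ (t\in[-\tau,0]).$$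
   Context: Model. Fix $\tau>0$, $\mu\ge 0$, $N\in\mathbb N=\{1,2,\dots\}$, and write $L=\lfloor \tau N\rfloor$. The state space is $\Omega_N=[0,\infty)^{L+1}$, with elements $x=(x_{-L},\dots,x_{-1},x_0)$ ($x_0$ is the ''present'', $x_{-L}$ the state $L$ jumps in the past). Define maps $\theta_N^\pm:\Omega_N\to\Omega_N$ by $(\theta_N^\pm x)_j=x_{j+1}$ for $-L\le j<0$, and $(\theta_N^+x)_0=x_0(1+\frac1N)$, $(\theta_N^-x)_0=\max\{x_0(1-\frac{x_{-L}}{N^2}),0\}$. Let $\xi^N=(\xi^N(n))_{n\ge0}$ be the discrete-time Markov chain on $\Omega_N$ which from $x$ moves to $\theta_N^+x$ with probability $1/2$ and to $\theta_N^-x$ with probability $1/2$, started from $\xi^N_j(0)=\mu N$ for all $j\in\{-L,\dots,0\}$. Let $(\sigma_n)_{n\ge1}$ be i.i.d. exponential random variables of parameter $1$, independent of $\xi^N$, $J_0=0$, $J_n=\sigma_1+\dots+\sigma_n$, and $X^N(t)=\xi^N(n)$ for $t\in[J_n,J_{n+1})$. Thus $X^N=(X^N_{-L}(t),\dots,X^N_0(t))_{t\ge0}$ is a continuous-time Markov chain with generator $\mathsf L_Nf(x)=\frac12(f(\theta_N^+x)-f(x))+\frac12(f(\theta_N^-x)-f(x))$. *)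

(* Defs.v *)
From HB Require Import structures.
From mathcomp Require Import all_boot all_order all_algebra.
From mathcomp Require Import all_classical all_reals all_analysis.
Set Implicit Arguments. Unset Strict Implicit. Unset Printing Implicit Defensive.
Import Order.TTheory GRing.Theory Num.Theory.
Import numFieldNormedType.Exports.
Local Open Scope classical_set_scope.
Local Open Scope ring_scope.

Section Defs.
Variable R : realType.

(* L = floor (tau N) (tau N >= 0 so truncation = floor) *)
Definition lag (tau : R) (N : nat) : nat := Num.truncn (tau * N%:R).

(* A state x = (x_{-L},...,x_0) is encoded as x : nat -> R with
   x k = x_{k-L} for 0 <= k <= L (so x 0 = x_{-L}, x L = x_0);
   entries k > L are irrelevant. *)
Definition state := nat -> R.

Definition theta_plus (N L : nat) (x : state) : state := fun k =>
  if (k < L)%N then x k.+1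
  else if k == L then x L * (1 + N%:R^-1) else x k.

Definition theta_minus (N L : nat) (x : state) : state := fun k =>
  if (k < L)%N then x k.+1
  else if k == L then Num.max (x L * (1 - x 0%N / N%:R ^+ 2)) 0 else x k.

Fixpoint chain (tau mu : R) (N : nat) (coin : nat -> R) (n : nat) : state :=
  match n with
  | 0%N => fun _ => mu * N%:R
  | m.+1 => if coin m == 1 then theta_plus N (lag tau N) (chain tau mu N coin m)
            else theta_minus N (lag tau N) (chain tau mu N coin m)
  end.

(* J_n = sigma_1 + ... + sigma_n, with sigma_{i+1} = sigma i *)
Definition jump_time (sigma : nat -> R) (n : nat) : R := \sum_(i < n) sigma i.

Definition jump_index (sigma : nat -> R) (t : R) : nat :=
  xget 0%N [set n | jump_time sigma n <= t < jump_time sigma n.+1].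

Definition cont_process (tau mu : R) (N : nat) (coin sigma : nat -> R) (t : R)
  : state := chain tau mu N coin (jump_index sigma t).

Definition rescaled (tau mu : R) (N : nat) (coin sigma : nat -> R) (t : R) : R :=
  if t < 0 then cont_process tau mu N coin sigma (N%:R * (t + tau)) 0%N / N%:R
  else cont_process tau mu N coin sigma (N%:R * t) (lag tau N) / N%:R.

Definition seg (a b : R) : set R := [set t | a <= t <= b].

Definition time_changes (a b : R) : set (R -> R) :=
  [set lam | lam a = a /\ lam b = b /\ {within seg a b, continuous lam} /\
     (forall s t, seg a b s -> seg a b t -> s < t -> lam s < lam t)].

Definition sk_dist (a b : R) (f g : R -> R) : \bar R :=
  ereal_inf [set e | exists lam, time_changes a b lam /\
    e = maxe (ereal_sup ((fun t => (`|lam t - t|)%:E) @` seg a b))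
             (ereal_sup ((fun t => (`|f t - g (lam t)|)%:E) @` seg a b))].

Definition hutchinson_sol (tau mu T : R) (u : R -> R) : Prop :=
  {within seg (- tau) T, continuous u} /\
  (forall t, - tau <= t <= 0 -> u t = mu) /\
  (forall t, 0 < t < T -> is_derive t 1 u (2^-1 * u t * (1 - u (t - tau)))).

Definition mutual_indep {d} {Om : measurableType d} (P : probability Om R)
  {I : eqType} (X : I -> Om -> R) : Prop :=
  forall (s : seq I) (A : I -> set R), uniq s -> (forall i, measurable (A i)) ->
    P (\bigcap_(i in [set` s]) (X i @^-1` A i)) = (\prod_(i <- s) P (X i @^-1` A i))%E.

(* convergence in (outer) probability of Y_N to u in the Skorokhod metric on [a,b] *)
Definition sk_cvg_in_prob {d} {Om : measurableType d} (P : probability Om R)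
  (a b : R) (Y : nat -> Om -> R -> R) (u : R -> R) : Prop :=
  forall eps : R, 0 < eps -> exists B : nat -> set Om,
    (forall N, measurable (B N) /\
       [set w | (eps%:E < sk_dist a b (Y N w) u)%E] `<=` B N) /\
    ((fun N => P (B N)) @ \oo --> 0%E).

End Defs.

(* Main.v *)
(* Write a(n) for the present coordinate of the chain divided by N.  Its drift
   over one jump is exactly one Euler step, of length 1/N, of the delayed
   logistic equation, and the remainder is a martingale.  Deterministically
   a(n) <= exp(n/N), so for large N the truncation at 0 is never active up to
   n = K N, and the martingale has increments O(1/N): Chebyshev's inequality at
   a fixed number of grid points controls it uniformly.  The jump times satisfy
   J_n = n + o(N) uniformly in n <= K N for the same reason, monotonicity taking
   care of the points between the grid points; to use only the tails of the
   exponential law, the holding times are rounded up to multiples of a small h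
   and written as sums of indicators.  On the resulting good event a discrete
   Gronwall inequality compares a(n) with u(n/N), uniformly in n, so the identity
   time change already shows that the Skorokhod distance is small. *)
Require Import Defs.
From HB Require Import structures.
From mathcomp Require Import all_boot all_order all_algebra.
From mathcomp Require Import all_classical all_reals all_analysis.
From mathcomp Require Import measurable_realfun ring lra zify.
Set Implicit Arguments. Unset Strict Implicit. Unset Printing Implicit Defensive.
Import Order.TTheory GRing.Theory Num.Theory.
Import numFieldNormedType.Exports.
Local Open Scope classical_set_scope.
Local Open Scope ring_scope.

(** * The delayed logistic equation *)

Lemma antiderivative_right {R : realType} (g : R -> R) (a : R) :
  continuous g ->
  exists G : R -> R, forall t : R, a < t -> is_derive t 1 G (g t).
Proof.
move=> cg; exists (fun x => \int[lebesgue_measure]_(t in `[a, x]) (g t))%R.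
move=> t at_.
have tu : t < t + 1 by rewrite ltrDl.
have ig : lebesgue_measure.-integrable `[a, t + 1] (EFin \o g).
  apply: continuous_compact_integrable; first exact: segment_compact.
  exact: continuous_subspaceT.
have [dG EG] := continuous_FTC1_closed tu ig at_ (cg t).
by apply: DeriveDef; [exact: dG|rewrite -derive1E; exact: EG].
Qed.

Lemma is_derive_continuous {R : realType} (f : R -> R) (x df : R) :
  is_derive x 1 f df -> {for x, continuous f}.
Proof. by move=> [fx _]; exact/differentiable_continuous/derivable1_diffP. Qed.

(* The iterates of the integral equation stabilise: the [k]th one is the
   solution up to time [k * tau], because the delayed argument only sees the
   previous delay interval. *)
Lemma hutchinson_iterates {R : realType} (tau mu : R) (k : nat) :
  0 < tau -> 0 < mu ->
  exists u u' : R -> R, [/\ continuous u, forall t : R, 0 < u t,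
    forall t : R, t <= 0 -> u t = mu,
    forall t : R, t <= k%:R * tau -> u' t = u t &
    continuous u' /\
    [/\ forall t : R, 0 < u' t, forall t : R, t <= 0 -> u' t = mu &
    forall t : R, 0 < t -> is_derive t 1 u' (2^-1 * u' t * (1 - u (t - tau)))]].
Proof.
move=> tau0 mu0.
(* With the delayed factor read off a known [u], the equation is linear in [u'], so the solution is
   the explicit exponential of a primitive, positive by its form. *)
have next (u : R -> R) : continuous u -> exists u' : R -> R,
    [/\ continuous u', forall t : R, 0 < u' t, forall t : R, t <= 0 -> u' t = mu &
    forall t : R, 0 < t -> is_derive t 1 u' (2^-1 * u' t * (1 - u (t - tau)))].
  move=> cu.
  have cg : continuous (fun t => 2^-1 * (1 - u (t - tau))).
    move=> t; apply: cvgM; first exact: cvg_cst.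
    apply: cvgB; first exact: cvg_cst.
    apply: continuous_comp; last exact: cu.
    by apply: cvgB; [exact: cvg_id|exact: cvg_cst].
  (* The base point [-1] lies left of [0], so the primitive is differentiable at [0] too, where the
     clamped argument [Num.max t 0] takes its values for [t <= 0]. *)
  have [G dG] := @antiderivative_right R _ (- 1) cg.
  have dE (t : R) : -1 < t -> is_derive t 1 (fun t => mu * expR (G t - G 0))
      (2^-1 * (mu * expR (G t - G 0)) * (1 - u (t - tau))).
    move=> t1; have dGt := dG _ t1.
    apply: is_derive_eq; rewrite /GRing.scale /=.
    by ring.
  exists (fun t => mu * expR (G (Num.max t 0) - G 0)); split.
  - move=> t.
    have c1 : {for Num.max t 0, continuous (fun t => mu * expR (G t - G 0))}.
      by apply: is_derive_continuous; apply: dE; rewrite lt_max ltrN10 orbT.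
    apply: (@continuous_comp _ _ _ (fun t : R => Num.max t 0)
      (fun t => mu * expR (G t - G 0))); last exact: c1.
    by apply: continuous_max; [exact: cvg_id|exact: cvg_cst].
  - by move=> t; rewrite mulr_gt0// expR_gt0.
  - by move=> t t0; rewrite (max_idPr t0) subrr expR0 mulr1.
  - move=> t t0.
    rewrite [X in _ * (_ * expR (G X - _)) * _](max_idPl (ltW t0)).
    apply: near_eq_is_derive (dE _ _); last exact: lt_trans t0.
    near=> s; rewrite max_l//; apply: ltW.
    by near: s; exact: lt_nbhsr.
elim: k => [|k [u [u' [cu u0 um uu' [cu' [u'0 u'm du']]]]]].
  have [u' [c' u'0 u'm du']] := next (cst mu) (fun x => cvg_cst _).
  exists (cst mu), u'; split=> //; first by move=> x; exact: cvg_cst.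
  by move=> t; rewrite mul0r => /u'm.
have [u'' [c'' u''0 u''m du'']] := next u' cu'.
exists u', u''; split=> //.
move=> t tk; have [t0|t0] := leP t 0; first by rewrite u''m// u'm.
(* For [x < t] the delayed time [x - tau] is at most [k * tau], where the two coefficients agree;
   both iterates then solve the same linear equation and their quotient has derivative zero. *)
suff : u'' t / u' t = 1.
  by move=> /(congr1 ( *%R^~ (u' t))); rewrite mulfVK ?mul1r// gt_eqF.
have dr (x : R) : x \in `]0, t[ -> is_derive x 1 (fun t => u'' t / u' t) 0.
  rewrite in_itv /= => /andP[x0 xt].
  have d1 := du'' _ x0; have d2 := du' _ x0.
  have nz : u' x != 0 by rewrite gt_eqF.
  have d3 := is_deriveV nz d2.
  apply: is_derive_eq; rewrite /GRing.scale /=.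
  rewrite (uu' (x - tau)); first by field.
  by rewrite lerBlDr (le_trans (ltW xt))// (le_trans tk)// -natr1; lra.
have [] := MVT t0 dr.
  apply: continuous_subspaceT => x; apply: cvgM; first exact: c''.
  by apply: cvgV; [rewrite gt_eqF|exact: cu'].
move=> c _; rewrite mul0r => /eqP; rewrite subr_eq0 => /eqP ->.
by rewrite u''m// u'm// divff// gt_eqF.
Unshelve. all: by end_near. Qed.

Lemma hutchinson_exists {R : realType} (tau mu H : R) : 0 < tau -> 0 < mu ->
  exists u : R -> R, [/\ continuous u, forall t : R, 0 < u t,
    forall t : R, t <= 0 -> u t = mu &
    forall t : R, 0 < t < H -> is_derive t 1 u (2^-1 * u t * (1 - u (t - tau)))].
Proof.
move=> tau0 mu0.
have [k Hk] : exists k, H <= k%:R * tau.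
  exists (Num.truncn (`|H| / tau)).+1.
  rewrite -ler_pdivrMr//; apply/ltW.
  have : 0 <= `|H| / tau by rewrite divr_ge0// ltW.
  move/truncn_itv => /andP[_]; apply: le_lt_trans.
  by rewrite ler_pM2r ?invr_gt0// ler_norm.
have [u [u' [_ _ _ uu' [cu' [u'0 u'm du']]]]] :=
  @hutchinson_iterates R tau mu k tau0 mu0.
exists u'; split=> // t /andP[t0 tH].
rewrite (uu' (t - tau)); last by lra.
exact: du'.
Qed.

(** Method of steps: once [u] and [v] agree up to [k * tau], on the next delay interval both solve
    the same linear equation. Positivity of [u] lets [v / u] be formed there, and its derivative
    vanishes. *)
Lemma hutchinson_unique {R : realType} (tau mu T : R) (u v : R -> R) :
  0 < tau -> (forall t : R, 0 < u t) ->
  hutchinson_sol tau mu T u -> hutchinson_sol tau mu T v ->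
  forall t : R, seg (- tau) T t -> v t = u t.
Proof.
move=> tau0 u0 [cu [um du]] [cv [vm dv]] t /andP[t1 tT].
suff step k : forall t : R, - tau <= t -> t <= T -> t <= k%:R * tau -> v t = u t.
  apply: (step (Num.truncn (`|t| / tau)).+1) => //.
  rewrite -ler_pdivrMr//; apply/ltW.
  have : 0 <= `|t| / tau by rewrite divr_ge0// ltW.
  move/truncn_itv => /andP[_]; apply: le_lt_trans.
  by rewrite ler_pM2r ?invr_gt0// ler_norm.
elim: k => [|k IH] {t1 tT}t t1 tT.
  by rewrite mul0r => t0; rewrite um ?vm// t1.
rewrite -natr1 mulrDl mul1r => tk.
have [t0|t0] := leP t 0; first by rewrite um ?vm// t1.
suff : v t / u t = 1.
  by move=> /(congr1 ( *%R^~ (u t))); rewrite mulfVK ?mul1r// gt_eqF.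
have dr (x : R) : x \in `]0, t[ -> is_derive x 1 (fun t => v t / u t) 0.
  rewrite in_itv /= => /andP[x0 xt].
  have x0T : 0 < x < T by rewrite x0 (lt_le_trans xt).
  have d1 := dv _ x0T; have d2 := du _ x0T.
  have nz : u x != 0 by rewrite gt_eqF.
  have d3 := is_deriveV nz d2.
  apply: is_derive_eq; rewrite /GRing.scale /=.
  rewrite (IH (x - tau)); [by field|lra|lra|lra].
have sub : `[0, t] `<=` seg (- tau) T.
  by move=> x /=; rewrite in_itv /= => /andP[x0 xt]; apply/andP; split; lra.
have [] := MVT t0 dr.
  have cu0 := continuous_subspaceW sub cu.
  have cv0 := continuous_subspaceW sub cv.
  move=> x; apply: cvgM; first exact: cv0.
  by apply: cvgV; [rewrite gt_eqF|exact: cu0].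
move=> c _; rewrite mul0r => /eqP; rewrite subr_eq0 => /eqP ->.
have seg0 : - tau <= (0 : R) <= 0.
  by rewrite lexx andbT oppr_le0 ltW.
by rewrite vm// -(um 0)// divff// gt_eqF.
Qed.

(** * Comparison with the Euler scheme *)

(** Compactness of [[0, H]] bounds [u], the equation then bounds the derivative by [B * (1 + B)],
    and the constant history extends both bounds to all earlier times through the 1-Lipschitz clamp
    [Num.max t 0]. *)
Lemma hutchinson_lipschitz {R : realType} (tau mu H : R) (u : R -> R) :
  0 < tau -> 0 < H -> continuous u -> (forall t : R, t <= 0 -> u t = mu) ->
  (forall t : R, 0 < t < H -> is_derive t 1 u (2^-1 * u t * (1 - u (t - tau)))) ->
  exists B C : R, [/\ 0 <= B, 0 <= C, forall t : R, t <= H -> `|u t| <= B &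
    forall s t : R, s <= H -> t <= H -> `|u s - u t| <= C * `|s - t|].
Proof.
move=> tau0 H0 cu um du.
have umax (t : R) : u t = u (Num.max t 0).
  by have [t0|//] := leP t 0; rewrite um// um.
have [c _ Bc] : exists2 c, c \in `[0, H] &
    forall t : R, t \in `[0, H] -> `|u t| <= `|u c|.
  apply: (@EVT_max R (fun t => `|u t|)); first exact: ltW.
  apply: continuous_subspaceT => x.
  exact: (@continuous_comp _ _ _ u Num.norm x (cu x) (@norm_continuous _ _ _)).
move: (normr_ge0 (u c)) Bc; move: `|u c| => B B0 Bc.
have uB (t : R) : t <= H -> `|u t| <= B.
  move=> tH; rewrite umax; apply: Bc.
  by rewrite in_itv /= le_max lexx orbT ge_max tH ltW.
have lip (s t : R) : 0 <= s -> s <= t -> t <= H ->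
    `|u s - u t| <= B * (1 + B) * `|s - t|.
  move=> s0 st tH.
  have dr (x : R) : x \in `]s, t[ -> is_derive x 1 u (2^-1 * u x * (1 - u (x - tau))).
    by rewrite in_itv /= => /andP[sx xt]; apply: du; apply/andP; split; lra.
  have [d] := MVT_segment st dr (continuous_subspaceT cu).
  rewrite in_itv /= => /andP[sd dt] E.
  rewrite distrC E normrM (distrC s) ler_wpM2r// !normrM.
  have a1 := uB _ (le_trans dt tH).
  have a2 : `|1 - u (d - tau)| <= 1 + B.
    rewrite (le_trans (ler_normB _ _))// normr1 lerD2l uB//; lra.
  rewrite ger0_norm// ler_pM// ?mulr_ge0//.
  by rewrite (le_trans _ a1)// ler_piMl//; lra.
exists B, (B * (1 + B)); split=> //; first by rewrite mulr_ge0// addr_ge0.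
move=> s t sH tH; rewrite umax (umax t).
have lipm : `|Num.max s 0 - Num.max t 0| <= `|s - t|.
  rewrite ler_norml; case: (leP s 0) => ?; case: (leP t 0) => ?;
  by case: (ler0P (s - t)) => ?; apply/andP; split; lra.
apply: le_trans (ler_wpM2l (mulr_ge0 B0 (addr_ge0 ler01 B0)) lipm).
have m0 (x : R) : 0 <= Num.max x 0 by rewrite le_max lexx orbT.
have mH (x : R) : x <= H -> Num.max x 0 <= H by rewrite ge_max (ltW H0) andbT.
have [mm|/ltW mm] := leP (Num.max s 0) (Num.max t 0).
  by apply: lip => //; exact: mH.
by rewrite distrC (distrC (Num.max s 0)); apply: lip => //; exact: mH.
Qed.

(* [y] is the error of the delayed argument: it is an error of [x] at an earlier
   index, so the increasing bound on [x] absorbs it. *)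
Lemma discrete_gronwall {R : realType} (c kappa delta : R) (x y M : nat -> R)
    (m : nat) :
  0 <= c -> x 0%N = 0 -> M 0%N = 0 ->
  (forall n, (n <= m)%N -> `|M n| <= delta) ->
  (forall n, exists2 j, (j <= n)%N & `|y n| <= `|x j|) ->
  (forall n, (n < m)%N -> `|(x n.+1 - M n.+1) - (x n - M n)| <=
     c * (`|x n| + `|y n| + 2 * kappa)) ->
  0 <= kappa ->
  forall n, (n <= m)%N -> `|x n| <= (delta + kappa) * (1 + 2 * c) ^+ n.
Proof.
move=> c0 x0 M0 Md yx step k0.
have d0 : 0 <= delta by rewrite (le_trans _ (Md _ (leq0n m)))// M0 normr0.
pose g n := (delta + kappa) * (1 + 2 * c) ^+ n.
have gmono i j : (i <= j)%N -> g i <= g j.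
  move=> ij; rewrite /g ler_wpM2l ?addr_ge0// ler_weXn2l//.
  by rewrite lerDl mulr_ge0.
(* The slack is what closes the induction: adding [delta] for [M] leaves [g n - kappa] for both [x]
   and [y], and the two spare [kappa] absorb the term [2 * kappa] of the step. *)
have key n : (n <= m)%N -> `|x n - M n| <= g n - delta - kappa.
  elim/ltn_ind: n => -[|n] IH nm.
    by rewrite x0 M0 subrr normr0 /g expr0; lra.
  have xg j : (j <= n)%N -> `|x j| <= g n - kappa.
    move=> jn; have jm := leq_trans jn (ltnW nm).
    have h1 := IH j jn jm; have h2 := Md j jm; have h3 := gmono _ _ jn.
    have := ler_normD (x j - M j) (M j); rewrite subrK => h4.
    by lra.
  have hx := xg n (leqnn n).
  have [j jn yj] := yx n; have hy := le_trans yj (xg j jn).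
  have h1 := IH n (ltnSn n) (ltnW nm); have h2 := step n nm.
  have h3 := ler_normD (x n.+1 - M n.+1 - (x n - M n)) (x n - M n).
  rewrite subrK in h3.
  have h4 : c * (`|x n| + `|y n| + 2 * kappa) <= c * (2 * g n).
    by rewrite ler_wpM2l//; lra.
  have -> : g n.+1 = g n + c * (2 * g n) by rewrite /g exprS; ring.
  by lra.
move=> n nm; have h1 := key n nm; have h2 := Md n nm.
have := ler_normD (x n - M n) (M n); rewrite subrK => h4.
by rewrite -/(g n); lra.
Qed.

Section deterministic.
Context {R : realType}.
Variables (tau mu : R) (N : nat) (coin : nat -> R).
Let L := lag tau N.

Definition present n : R := chain tau mu N coin n L / N%:R.
Definition delayed n : R := chain tau mu N coin n 0%N / N%:R.

(* The martingale part of [present], see [presentS]. *)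
Definition noise n : R := \sum_(m < n)
  N%:R^-1 * ((coin m == 1)%:R - 2^-1) * present m * (1 + delayed m).

(** A jump moves each stored value one place towards the past and leaves it unchanged, so the state
    is determined by the history of its newest coordinate. *)
Lemma chain_shift n k : (k <= L)%N -> chain tau mu N coin n k =
  if (n + k <= L)%N then mu * N%:R else chain tau mu N coin (n + k - L)%N L.
Proof.
elim: n k => [|n IH] k kL; first by rewrite add0n kL.
have [kL'|] := ltnP k L.
  have -> : chain tau mu N coin n.+1 k = chain tau mu N coin n k.+1.
    by rewrite /=; case: ifP => _; rewrite ?/theta_plus ?/theta_minus -/L kL'.
  by rewrite IH// addSnnS.
move=> Lk; have -> : k = L by apply/eqP; rewrite eqn_leq kL.
have -> : (n.+1 + L <= L)%N = false by lia.
by rewrite addnK.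
Qed.

Lemma delayedE n :
  delayed n = if (n <= L)%N then mu * N%:R / N%:R else present (n - L)%N.
Proof. by rewrite /delayed chain_shift// addn0 /present; case: ifP. Qed.

Hypotheses (mu0 : 0 < mu) (mu1 : mu < 1).

(** For every coin sequence a jump multiplies the newest coordinate by at most [1 + 1/N]: since the
    past is nonnegative, a downward jump cannot increase it. The maximum with [0] keeps it
    nonnegative. *)
Lemma chain_bound n k : (k <= L)%N -> 0 <= chain tau mu N coin n k <=
  N%:R * (1 + N%:R^-1) ^+ n.
Proof.
have N0 : 0 <= N%:R^-1 :> R by rewrite invr_ge0.
elim: n k => [|n IH] k kL.
  rewrite expr0 /= mulr1; apply/andP; split; first by rewrite mulr_ge0// ltW.
  by rewrite ler_piMl// ltW.
set g := _ * _ ^+ n in IH.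
have -> : N%:R * (1 + N%:R^-1) ^+ n.+1 = g * (1 + N%:R^-1) :> R.
  by rewrite exprSr mulrA.
have g0 : 0 <= g by have /andP[a b] := IH L (leqnn L); exact: le_trans b.
have gg : g <= g * (1 + N%:R^-1) by rewrite ler_peMr// lerDl.
have /andP[a0 ag] := IH L (leqnn L).
have /andP[b0 bg] := IH 0%N (leq0n L).
rewrite /=; case: ifP => _; rewrite /theta_plus /theta_minus -/L.
  case: ifP => kL'; first by have /andP[-> h] := IH k.+1 kL'; rewrite (le_trans h).
  have -> : k = L by lia.
  by rewrite eqxx mulr_ge0 ?addr_ge0//= ler_wpM2r// addr_ge0.
case: ifP => kL'; first by have /andP[-> h] := IH k.+1 kL'; rewrite (le_trans h).
have -> : k = L by lia.
rewrite eqxx le_max lexx orbT /= ge_max (le_trans g0 gg) andbT.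
rewrite (le_trans _ gg)// (le_trans _ ag)// ler_piMr// gerBl.
by rewrite divr_ge0// exprn_ge0.
Qed.

Variable K : nat.
Hypothesis N0 : (0 < N)%N.

(** Serves twice: with [c = 1] for the a priori bound on the chain, with [c = 1 + B] for the
    Gronwall factor. *)
Lemma growth_bound n (c : R) : 0 <= c -> (n <= K * N)%N ->
  (1 + c / N%:R) ^+ n <= expR (c * K%:R).
Proof.
move=> c0 nK; have Np : 0 < N%:R :> R by rewrite ltr0n.
have h : 0 <= c / N%:R by rewrite divr_ge0.
apply: (@le_trans _ _ (expR (c / N%:R) ^+ n)).
  by rewrite lerXn2r ?nnegrE ?addr_ge0 ?expR_ge0// expR_ge1Dx.
rewrite -expRM_natl ler_expR mulrCA ler_wpM2l// ler_pdivrMr//.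
by rewrite -natrM ler_nat.
Qed.

Lemma present_bound n : (n <= K * N)%N -> 0 <= present n <= expR K%:R.
Proof.
move=> nK; have Np : 0 < N%:R :> R by rewrite ltr0n.
have /andP[a b] := chain_bound n (leqnn L).
rewrite /present divr_ge0//= ler_pdivrMr// mulrC (le_trans b)//.
rewrite ler_pM2l//; have := growth_bound ler01 nK.
by rewrite mul1r mul1r.
Qed.

Lemma delayed_bound n : (n <= K * N)%N -> 0 <= delayed n <= expR K%:R.
Proof.
move=> nK; have Np : 0 < N%:R :> R by rewrite ltr0n.
have /andP[a b] := chain_bound n (leq0n L).
rewrite /delayed divr_ge0//= ler_pdivrMr// mulrC (le_trans b)//.
rewrite ler_pM2l//; have := growth_bound ler01 nK.
by rewrite mul1r mul1r.
Qed.

(** Once [expR K <= N], the delayed value is at most [N], so the truncation at [0] is inactive. The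
    mean of the two jumps is then the Euler drift and the deviation from it is the increment of
    [noise]. *)
Lemma presentS n : expR K%:R <= N%:R :> R -> (n <= K * N)%N ->
  present n.+1 = present n +
    N%:R^-1 * (2^-1 * present n * (1 - delayed n)) + (noise n.+1 - noise n).
Proof.
move=> KN nK; have Np : 0 < N%:R :> R by rewrite ltr0n.
have /andP[p0 _] := present_bound nK; have /andP[d0 dK] := delayed_bound nK.
rewrite /noise big_ord_recr /= -/(noise n).
have -> : noise n +
    N%:R^-1 * ((coin n == 1)%:R - 2^-1) * present n * (1 + delayed n) - noise n =
    N%:R^-1 * ((coin n == 1)%:R - 2^-1) * present n * (1 + delayed n) by ring.
rewrite {1}/present /= -/L.
case: (coin n == 1); rewrite /theta_plus /theta_minus -/L ltnn eqxx /=.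
  by rewrite /present /delayed; field; rewrite gt_eqF.
rewrite max_l.
  by rewrite /present /delayed; field; rewrite gt_eqF.
have /andP[a _] := chain_bound n (leqnn L).
rewrite mulr_ge0// subr_ge0 expr2 invfM mulrA -/(delayed n).
by rewrite ler_pdivrMr// mul1r (le_trans dK).
Qed.

Variable u : R -> R.
Variables (B C delta : R).
Hypotheses (tau0 : 0 < tau) (cu : continuous u).
Hypothesis um : forall t : R, t <= 0 -> u t = mu.
Hypothesis du : forall t : R, 0 < t < K%:R ->
  is_derive t 1 u (2^-1 * u t * (1 - u (t - tau))).
Hypotheses (B0 : expR K%:R <= B) (C0 : 0 <= C).
Hypothesis uB : forall t : R, t <= K%:R -> `|u t| <= B.
Hypothesis uC : forall s t : R, s <= K%:R -> t <= K%:R -> `|u s - u t| <= C * `|s - t|.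
Hypothesis KN : expR K%:R <= N%:R :> R.
Hypothesis noise_small : forall n, (n <= K * N)%N -> `|noise n| <= delta.

Lemma lag_itv : L%:R <= tau * N%:R < L%:R + 1.
Proof.
have := truncn_itv (mulr_ge0 (ltW tau0) (ler0n R N)).
by rewrite -/(lag tau N) -/L natr1.
Qed.

Let errp n := present n - u (n%:R / N%:R).
(** The comparison time is the grid point [(n - L) / N] and not [n / N - tau]: this makes [errd n]
    equal to [errp (n - L)], or zero while the initial history is still being read. *)
Let errd n := delayed n - u ((n%:R - L%:R) / N%:R).

Let errd_errp n : exists2 j, (j <= n)%N & `|errd n| <= `|errp j|.
Proof.
have Np : 0 < N%:R :> R by rewrite ltr0n.
rewrite /errd delayedE; case: ifP => nL.
  exists 0%N => //; rewrite um ?mulfK ?subrr ?normr0// ?gt_eqF//.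
  by rewrite pmulr_lle0 ?invr_gt0// subr_le0 ler_nat.
exists (n - L)%N; first exact: leq_subr.
by rewrite /errp natrB//; lia.
Qed.

Lemma present_close n : (n <= K * N)%N ->
  `|errp n| <= (delta + 3 / 2 * C / N%:R) * expR ((1 + B) * K%:R).
Proof.
move=> nK; have Np : 0 < N%:R :> R by rewrite ltr0n.
have B1 : 0 <= B by rewrite (le_trans _ B0)// expR_ge0.
have k0 : 0 <= 3 / 2 * C / N%:R by rewrite !mulr_ge0// invr_ge0 ltW.
have d0 : 0 <= delta by rewrite (le_trans _ (noise_small (leq0n _))).
(* Gronwall with [kappa = 3 / 2 * C / N]: replacing the intermediate time by grid points costs
   [C / N] in the present factor and [2 * C / N] in the delayed one, in total [2 * kappa]. *)
apply: (@le_trans _ _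
    ((delta + 3 / 2 * C / N%:R) * (1 + 2 * ((1 + B) / 2 / N%:R)) ^+ n)).
  apply: (@discrete_gronwall _ _ _ _ errp errd noise (K * N)) => //.
  - by rewrite !mulr_ge0// ?invr_ge0 ?ltW//; lra.
  - by rewrite /errp /present /= mul0r um// mulfK ?subrr// gt_eqF//.
  - by rewrite /noise big_ord0.
  move=> m mK.
  have mN : m%:R / N%:R < m.+1%:R / N%:R :> R.
    by rewrite ltr_pM2r ?invr_gt0// ltr_nat.
  have mNK : m.+1%:R / N%:R <= K%:R :> R by rewrite ler_pdivrMr// -natrM ler_nat.
  have m0 : 0 <= m%:R / N%:R :> R by rewrite divr_ge0.
  have dr (x : R) : x \in `]m%:R / N%:R, m.+1%:R / N%:R[ ->
      is_derive x 1 u (2^-1 * u x * (1 - u (x - tau))).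
    by rewrite in_itv /= => /andP[sx xt]; apply: du; apply/andP; split; lra.
  (* The increment of [u] over a step is [1/N] times the right-hand side at one intermediate time
     [z], so comparing it with the Euler step takes only the Lipschitz bound on [u]. *)
  have [z] := MVT mN dr (continuous_subspaceT cu).
  rewrite in_itv /= => /andP[mz zm] uE.
  have zt : z - tau <= K%:R.
    by rewrite lerBlDr (le_trans (ltW zm))// (le_trans mNK)// lerDl ltW.
  have stepE : m.+1%:R / N%:R - m%:R / N%:R = N%:R^-1 :> R.
    by rewrite -mulrBl -natr1 addrAC subrr add0r mul1r.
  have -> : errp m.+1 - noise m.+1 - (errp m - noise m) =
      2^-1 * N%:R^-1 * (present m * (1 - delayed m) - u z * (1 - u (z - tau))).
    rewrite /errp presentS ?(ltnW mK)//.
    have -> : u (m.+1%:R / N%:R) = u (m%:R / N%:R) +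
       2^-1 * u z * (1 - u (z - tau)) * N%:R^-1.
      by rewrite stepE in uE; rewrite -uE; ring.
    by ring.
  have /andP[p0 pK] := present_bound (ltnW mK).
  have -> : present m * (1 - delayed m) - u z * (1 - u (z - tau)) =
     (present m - u z) * (1 - u (z - tau)) + present m * (u (z - tau) - delayed m).
    by ring.
  have b1 : `|present m - u z| <= `|errp m| + C / N%:R.
    rewrite /errp -[present m - u z](subrKA (u (m%:R / N%:R))).
    rewrite (le_trans (ler_normD _ _))// lerD2l.
    rewrite (le_trans (uC _ _))//; [lra|lra|].
    by rewrite ler_wpM2l//; rewrite distrC ger0_norm; lra.
  (* Moving [z] to the grid and rounding [tau * N] down to [L] each shift the time by at most
     [1/N]. *)
  have b2 : `|u (z - tau) - delayed m| <= `|errd m| + 2 * C / N%:R.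
    rewrite /errd distrC -[delayed m - u (z - tau)](subrKA (u ((m%:R - L%:R) / N%:R))).
    have /andP[l1 l2] := lag_itv.
    have l3 : L%:R / N%:R <= tau by rewrite ler_pdivrMr.
    have l4 : tau <= L%:R / N%:R + N%:R^-1.
      by rewrite -[X in _ + X]mul1r -mulrDl ler_pdivlMr// ltW.
    rewrite (le_trans (ler_normD _ _))// lerD2l.
    rewrite (le_trans (uC _ _))// ?mulrBl.
      have : 0 <= L%:R / N%:R :> R by rewrite divr_ge0.
      by lra.
    rewrite [2 * C]mulrC -mulrA ler_wpM2l// ler_norml.
    by apply/andP; split; lra.
  have b3 : `|1 - u (z - tau)| <= 1 + B.
    by rewrite (le_trans (ler_normB _ _))// normr1 lerD2l uB.
  have b4 : `|present m| <= 1 + B.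
    by rewrite ger0_norm// (le_trans pK)// (le_trans B0)// lerDr.
  have n0 : 0 <= 2^-1 / N%:R :> R by rewrite mulr_ge0 ?invr_ge0// ltW.
  rewrite normrM (ger0_norm n0).
  have -> : (1 + B) / 2 / N%:R * (`|errp m| + `|errd m| + 2 * (3 / 2 * C / N%:R)) =
    2^-1 / N%:R * ((`|errp m| + C / N%:R) * (1 + B) +
                   (1 + B) * (`|errd m| + 2 * C / N%:R)).
    by field; rewrite gt_eqF.
  rewrite ler_wpM2l//.
  rewrite (le_trans (ler_normD _ _))// (normrM (present m - u z)) (normrM (present m)).
  by apply: lerD; apply: ler_pM.
rewrite ler_wpM2l ?addr_ge0//.
have -> : 2 * ((1 + B) / 2 / N%:R) = (1 + B) / N%:R by field; rewrite gt_eqF.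
by apply: growth_bound => //; rewrite addr_ge0.
Qed.

Lemma delayed_close n : (n <= K * N)%N ->
  `|errd n| <= (delta + 3 / 2 * C / N%:R) * expR ((1 + B) * K%:R).
Proof.
move=> nK; have [j jn /le_trans] := errd_errp n; apply.
exact: present_close (leq_trans jn nK).
Qed.

End deterministic.

(** * From jump counts to continuous time *)

Lemma jump_timeS {R : realType} (sigma : nat -> R) n :
  jump_time sigma n.+1 = jump_time sigma n + sigma n.
Proof. by rewrite /jump_time big_ord_recr. Qed.

Lemma jump_time_homo {R : realType} (sigma : nat -> R) :
  (forall i, 0 < sigma i) ->
  {homo jump_time sigma : m n / (m <= n)%N >-> m <= n}.
Proof.
move=> s0; apply: homo_leq => //; first by move=> ???; exact: le_trans.
by move=> n; rewrite jump_timeS lerDl ltW.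
Qed.

(** The default of [xget] does not interfere: the least index whose jump time exceeds [x] is
    positive because [J_0 = 0 <= x], and its predecessor is a witness. Monotonicity of the jump
    times gives the bound by [m]. *)
Lemma jump_indexP {R : realType} (sigma : nat -> R) (x : R) m :
  (forall i, 0 < sigma i) -> 0 <= x < jump_time sigma m ->
  let n := jump_index sigma x in
  (n < m)%N /\ jump_time sigma n <= x < jump_time sigma n.+1.
Proof.
move=> s0 /andP[x0 xm] n.
have ex : exists k, x < jump_time sigma k by exists m.
have nP : jump_time sigma n <= x < jump_time sigma n.+1.
  have [[|k] xk kmin] := ex_minnP ex.
    by move: xk; rewrite /jump_time big_ord0 ltNge x0.
  apply: (@xgetPex _ 0%N [set n | jump_time sigma n <= x < jump_time sigma n.+1]).
  exists k; rewrite /= xk andbT leNgt.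
  by apply/negP => /kmin; rewrite ltnn.
split=> //; rewrite ltnNge; apply/negP => mn.
have := le_trans (jump_time_homo s0 mn) (proj1 (andP nP)).
by rewrite leNgt xm.
Qed.

(** All the randomness sits in the two smallness hypotheses; [delta] and [N0] are fixed before
    [coin] and [sigma], so the estimate holds pathwise on the good event. *)
Lemma rescaled_close {R : realType} (tau mu T : R) (K : nat) (u : R -> R) :
  0 < tau -> 0 < mu < 1 -> 0 < T -> T + tau + 2 <= K%:R ->
  continuous u -> (forall t : R, t <= 0 -> u t = mu) ->
  (forall t : R, 0 < t < K%:R ->
    is_derive t 1 u (2^-1 * u t * (1 - u (t - tau)))) ->
  forall eps : R, 0 < eps -> exists2 delta : R, 0 < delta &
  exists N0 : nat, forall N, (N0 <= N)%N -> forall coin sigma : nat -> R,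
    (forall i, 0 < sigma i) ->
    (forall n, (n <= K * N)%N -> `|jump_time sigma n - n%:R| <= delta * N%:R) ->
    (forall n, (n <= K * N)%N -> `|noise tau mu N coin n| <= delta) ->
    forall t, seg (- tau) T t -> `|rescaled tau mu N coin sigma t - u t| <= eps.
Proof.
move=> tau0 /andP[mu0 mu1] T0 TK cu um du eps eps0.
have K0 : 0 < K%:R :> R by lra.
have [B' [C [B'0 C0 uB' uC]]] := hutchinson_lipschitz tau0 K0 cu um du.
pose B := B' + expR K%:R.
have B0 : expR K%:R <= B by rewrite /B lerDr.
have uB (t : R) : t <= K%:R -> `|u t| <= B.
  by move=> /uB' /le_trans; apply; rewrite /B lerDl expR_ge0.
pose G := expR ((1 + B) * K%:R).
have G0 : 0 < G by exact: expR_gt0.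
(* [W] collects the total error per unit of [delta]: [(1 + 2 * C) * G] from the Gronwall bound,
   [3 * C] from the time shift, and [1] to keep it positive. *)
pose W := (1 + 2 * C) * G + 3 * C + 1.
have W0 : 0 < W.
  have : 0 <= (1 + 2 * C) * G by rewrite mulr_ge0 ?(ltW G0)//; lra.
  by rewrite /W; lra.
pose delta := Num.min 2^-1 (eps / W).
have d0 : 0 < delta by rewrite lt_min invr_gt0 ltr0n/= divr_gt0.
exists delta => //.
exists (maxn (Num.truncn delta^-1).+1 (Num.truncn (expR K%:R : R)).+1).
move=> N; rewrite geq_max => /andP[N1 N2] coin sigma s0 Jd Md t /andP[tt tT].
have Np : (0 < N)%N := leq_trans (ltn0Sn _) N1.
have N0 : 0 < N%:R :> R by rewrite ltr0n.
have KN : expR K%:R <= N%:R :> R.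
  have /andP[_ h] := truncn_itv (expR_ge0 (K%:R : R)).
  by rewrite (le_trans (ltW h))// ler_nat.
have Nd : N%:R^-1 <= delta.
  have /andP[_ h] := truncn_itv (ltW (etrans (invr_gt0 delta) d0)).
  rewrite -[delta]invrK lef_pV2 ?posrE ?invr_gt0//.
  by rewrite (le_trans (ltW h))// ler_nat.
have d1 : delta <= 2^-1 by rewrite ge_min lexx.
have We : delta * W <= eps by rewrite -ler_pdivlMr// ge_min lexx orbT.
(* The margin [2] in [K] and [delta <= 1/2] put [N * s] before the jump [K * N]. The index error has
   one [delta] from the jump times and one from the step to the next jump, as [1 <= delta * N]. *)
have index s : 0 <= s -> s <= T + tau ->
    let n := jump_index sigma (N%:R * s) in
    (n <= K * N)%N /\ `|n%:R / N%:R - s| <= 2 * delta.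
  move=> ss sT n.
  have sN : N%:R * s <= N%:R * (K%:R - 2) by rewrite ler_pM2l//; lra.
  have [|nK /andP[h1 h2]] := @jump_indexP _ sigma (N%:R * s) (K * N) s0.
    rewrite mulr_ge0//=; have := Jd _ (leqnn (K * N)%N).
    rewrite natrM ler_norml => /andP[h _].
    have h3 : delta * N%:R <= 2^-1 * N%:R by rewrite ler_pM2r.
    by apply: (le_lt_trans sN); lra.
  split; first exact: ltnW.
  have := Jd _ (ltnW nK); rewrite ler_norml -/n => /andP[h3 h4].
  have := Jd _ nK; rewrite ler_norml -/n -natr1 => /andP[h5 h6].
  have h7 : 1 <= delta * N%:R by rewrite -ler_pdivrMr// mul1r.
  have -> : n%:R / N%:R - s = (n%:R - N%:R * s) / N%:R by field; rewrite gt_eqF.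
  rewrite normrM (gtr0_norm (_ : 0 < N%:R^-1)) ?invr_gt0// ler_pdivrMr//.
  by rewrite -/n in h1 h2; rewrite ler_norml; apply/andP; split; lra.
have err : (delta + 3 / 2 * C / N%:R) * G + 3 * delta * C <= eps.
  apply: le_trans We; rewrite /W.
  have h1 : 3 / 2 * C / N%:R <= 2 * C * delta.
    by rewrite ler_pM ?mulr_ge0 ?invr_ge0 ?(ltW N0)// ler_wpM2r//; lra.
  have h2 : (delta + 3 / 2 * C / N%:R) * G <= (delta + 2 * C * delta) * G.
    by rewrite ler_wpM2r ?(ltW G0)// lerD2l.
  by apply: le_trans (lerD h2 (lexx _)) _; lra.
(* For negative times the oldest coordinate is read. A fast clock may already have passed the
   initial history there; [delayed_close] covers this case as well. *)
rewrite /rescaled; case: ifPn => t0.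
  have [||nK nd] := index (t + tau); [lra|lra|].
  rewrite /cont_process; set n := jump_index _ _ in nK nd *.
  have e1 := delayed_close mu0 mu1 Np tau0 cu um du B0 C0 uB uC KN Md nK.
  have /andP[l1 l2] := @lag_itv R tau N tau0.
  have l3 : (lag tau N)%:R / N%:R <= tau by rewrite ler_pdivrMr.
  have l4 : tau <= (lag tau N)%:R / N%:R + N%:R^-1.
    by rewrite -[X in _ + X]mul1r -mulrDl ler_pdivlMr// ltW.
  have l5 : 0 <= (lag tau N)%:R / N%:R :> R by rewrite divr_ge0.
  have nK' : n%:R / N%:R <= K%:R :> R by rewrite ler_pdivrMr// -natrM ler_nat.
  have e2 : `|u ((n%:R - (lag tau N)%:R) / N%:R) - u t| <= 3 * delta * C.
    rewrite (le_trans (uC _ _ _ _))//; [by rewrite mulrBl; lra|lra|].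
    rewrite mulrC ler_wpM2r// mulrBl.
    move: nd; rewrite !ler_norml => /andP[n1 n2].
    by apply/andP; split; lra.
  apply: le_trans err.
  rewrite -/(delayed tau mu N coin n).
  rewrite -(subrKA (u ((n%:R - (lag tau N)%:R) / N%:R))).
  by rewrite (le_trans (ler_normD _ _))// lerD.
rewrite -leNgt in t0.
have [||nK nd] := index t; [lra|lra|].
rewrite /cont_process; set n := jump_index _ _ in nK nd *.
have e1 := present_close mu0 mu1 Np tau0 cu um du B0 C0 uB uC KN Md nK.
have nK' : n%:R / N%:R <= K%:R :> R by rewrite ler_pdivrMr// -natrM ler_nat.
have e2 : `|u (n%:R / N%:R) - u t| <= 3 * delta * C.
  rewrite (le_trans (uC _ _ _ _))//; [lra|].
  by rewrite mulrC ler_wpM2r//; lra.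
apply: le_trans err.
rewrite -/(present tau mu N coin n).
rewrite -(subrKA (u (n%:R / N%:R))).
by rewrite (le_trans (ler_normD _ _))// lerD.
Qed.

(** * The martingale part *)

Lemma sum_const_seq {R : pzSemiRingType} (T : Type) (l : seq T) (x : R) :
  \sum_(i <- l) x = x * (size l)%:R.
Proof. by rewrite big_const_seq count_predT iter_addr_0 mulr_natr. Qed.

(** The sample space of [n] fair coins as a finite list, so that expectations become finite sums.
    Words grow at the end, where the newest coin is. *)
Fixpoint patterns (n : nat) : seq (seq bool) :=
  if n is m.+1 then [seq rcons s true | s <- patterns m] ++
                    [seq rcons s false | s <- patterns m]
  else [:: [::]].

Lemma size_patterns n : size (patterns n) = (2 ^ n)%N.
Proof. by elim: n => //= n IH; rewrite size_cat !size_map IH addnn expnS mul2n. Qed.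

Lemma mem_patterns n s : (s \in patterns n) = (size s == n).
Proof.
elim: n s => [|n IH] s; first by case: s.
rewrite /= mem_cat; apply/idP/eqP => [/orP[] /mapP[t]|].
- by rewrite IH => /eqP <- ->; rewrite size_rcons.
- by rewrite IH => /eqP <- ->; rewrite size_rcons.
case/lastP: s => // s b; rewrite size_rcons => -[sn].
by case: b; apply/orP; [left|right]; apply: map_f; rewrite IH sn.
Qed.

Definition coin_of {R : realType} (s : seq bool) : nat -> R :=
  fun m => (nth false s m)%:R.

(** Any value other than [1] counts as a downward jump, exactly as in [chain]. *)
Definition pattern {R : realType} (coin : nat -> R) (n : nat) : seq bool :=
  mkseq (fun m => coin m == 1) n.

Lemma coin_of_pattern {R : realType} (coin : nat -> R) n m : (m < n)%N ->
  (coin_of (pattern coin n) m == 1 :> R) = (coin m == 1).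
Proof.
move=> mn; rewrite /coin_of nth_mkseq//.
by case: (coin m == 1); rewrite ?eqxx// eq_sym oner_eq0.
Qed.

Lemma coin_of_rcons {R : realType} (s : seq bool) b m : (m < size s)%N ->
  (coin_of (rcons s b) m == 1 :> R) = (coin_of s m == 1 :> R).
Proof. by move=> ms; rewrite /coin_of nth_rcons ms. Qed.

Section coins.
Context {R : realType}.
Variables (tau mu : R) (N : nat).

Lemma chain_ext (c c' : nat -> R) n :
  (forall m, (m < n)%N -> (c m == 1) = (c' m == 1)) ->
  chain tau mu N c n = chain tau mu N c' n.
Proof.
elim: n => // n IH cc'; rewrite /= cc'// IH// => m mn.
by apply: cc'; rewrite ltnS ltnW.
Qed.

Lemma noise_ext (c c' : nat -> R) n :
  (forall m, (m < n)%N -> (c m == 1) = (c' m == 1)) ->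
  noise tau mu N c n = noise tau mu N c' n.
Proof.
move=> cc'; apply: eq_bigr => m _.
have e : chain tau mu N c m = chain tau mu N c' m.
  by apply: chain_ext => k km; apply: cc'; exact: ltn_trans km _.
by rewrite /present /delayed e cc'.
Qed.

Hypotheses (mu0 : 0 < mu) (mu1 : mu < 1) (N0 : (0 < N)%N).
Variable K : nat.

(** Up to index [K * N] both [present] and [delayed] are at most [expR K]; this bounds the
    coefficient of the centred coin in an increment of [noise]. *)
Definition noise_step : R := expR K%:R * (1 + expR K%:R) / N%:R.

Lemma noise_step_ge0 : 0 <= noise_step.
Proof. by rewrite /noise_step !mulr_ge0 ?addr_ge0 ?invr_ge0 ?expR_ge0. Qed.

Lemma noise_incr (c : nat -> R) n : (n <= K * N)%N ->
  `|N%:R^-1 * present tau mu N c n * (1 + delayed tau mu N c n)| <= noise_step.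
Proof.
move=> nK; have /andP[p0 pK] := present_bound tau c mu0 mu1 N0 nK.
have /andP[d0 dK] := delayed_bound tau c mu0 mu1 N0 nK.
rewrite ger0_norm; last first.
  by apply: mulr_ge0; [apply: mulr_ge0; rewrite ?invr_ge0|exact: addr_ge0].
rewrite /noise_step -mulrA mulrC ler_wpM2r//.
by apply: ler_pM => //; rewrite ?addr_ge0// lerD2l.
Qed.

Lemma noise_lipschitz (c : nat -> R) m n : (n + m <= K * N)%N ->
  `|noise tau mu N c (n + m) - noise tau mu N c n| <= m%:R * noise_step.
Proof.
elim: m => [|m IH] nK; first by rewrite addn0 subrr normr0 mul0r.
rewrite addnS in nK *; rewrite /noise big_ord_recr /= -/(noise _ _ _ _ _).
rewrite addrAC (le_trans (ler_normD _ _))//.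
rewrite -[m.+1%:R]natr1 mulrDl mul1r lerD ?IH ?(ltnW nK)//.
apply: le_trans (noise_incr c (ltnW nK)).
have -> (a b p q : R) : a * b * p * q = b * (a * p * q) by ring.
by rewrite normrM ler_piMl// ler_norml; case: eqP => _ /=; apply/andP; split; lra.
Qed.

(* Averaging over the last coin kills the cross term. *)
Lemma noise_second_moment n : (n <= K * N)%N ->
  \sum_(s <- patterns n) noise tau mu N (coin_of s) n ^+ 2
    <= 2 ^+ n * (n%:R * noise_step ^+ 2).
Proof.
elim: n => [|n IH] nK.
  by rewrite big_seq1 /noise big_ord0 expr0n /= mul0r mulr0.
have {}IH := IH (ltnW nK).
rewrite /= big_cat !big_map /= -big_split /=.
apply: (@le_trans _ _ (\sum_(s <- patterns n)
    (2 * noise tau mu N (coin_of s) n ^+ 2 + 2 * noise_step ^+ 2))).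
  rewrite !big_seq; apply: ler_sum => s; rewrite mem_patterns => /eqP sn.
  have h b : noise tau mu N (coin_of (rcons s b)) n.+1 =
      noise tau mu N (coin_of s) n + (b%:R - 2^-1) *
      (N%:R^-1 * present tau mu N (coin_of s) n * (1 + delayed tau mu N (coin_of s) n)).
    rewrite {1}/noise big_ord_recr /= -/(noise _ _ _ _ n).
    rewrite (@noise_ext _ (coin_of s)); last first.
      by move=> m mn; rewrite coin_of_rcons// sn.
    congr (_ + _); rewrite /present /delayed (@chain_ext _ (coin_of s)); last first.
      by move=> m mn; rewrite coin_of_rcons// sn.
    rewrite /coin_of nth_rcons sn ltnn eqxx.
    by case: b; rewrite /= ?eqxx ?(negbTE (oner_neq0 _)) 1?eq_sym ?oner_eq0 /=; ring.
  rewrite !h; have := noise_incr (coin_of s) (ltnW nK).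
  set M := noise _ _ _ _ _; set a := _ * _ * _ => ha.
  have : a ^+ 2 <= noise_step ^+ 2.
    by rewrite -(real_normK (num_real a)) lerXn2r// nnegrE noise_step_ge0.
  move: (sqr_ge0 noise_step); rewrite /= mulr0n mulr1n.
  set c2 := noise_step ^+ 2; move: c2 => c2 c20 ac.
  have -> : (M + (1 - 2^-1) * a) ^+ 2 + (M + (0 - 2^-1) * a) ^+ 2 =
     2 * M ^+ 2 + 2^-1 * a ^+ 2 by field.
  by rewrite lerD2l; lra.
rewrite big_split /= -mulr_sumr sum_const_seq size_patterns.
rewrite natrX [2 ^+ n.+1]exprS -[n.+1%:R]natr1.
have -> : 2 * 2 ^+ n * ((n%:R + 1) * noise_step ^+ 2) =
  2 * (2 ^+ n * (n%:R * noise_step ^+ 2)) + 2 * noise_step ^+ 2 * 2 ^+ n by ring.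
by rewrite lerD2r ler_pM2l.
Qed.

Context {d : measure_display} {Om : measurableType d} (P : probability Om R).

(** The law of the coins in finite form: each word of length [n] has probability [2^-n]. *)
Definition fair_coins (X : nat -> Om -> R) := forall s : seq bool,
  let A := [set w | pattern (X ^~ w) (size s) = s] in
  measurable A /\ P A = (2^-1 ^+ size s)%:E.

Lemma fair_coins_seq (X : nat -> Om -> R) n (l : seq (seq bool)) :
  fair_coins X -> all (fun s => size s == n) l ->
  let A := [set w | pattern (X ^~ w) n \in l] in
  measurable A /\ (P A <= ((size l)%:R / 2 ^+ n)%:E)%E.
Proof.
move=> fX; elim: l => [|s l IH] /=.
  move=> _; have -> : [set w | pattern (X ^~ w) n \in [::]] = set0.
    by apply/seteqP; split.
  by split; [exact: measurable0|rewrite measure0 mul0r].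
move=> /andP[/eqP sn /IH[m1 P1]].
have [m2 P2] := fX s; rewrite sn in m2 P2.
have -> : [set w | pattern (X ^~ w) n \in s :: l] =
    [set w | pattern (X ^~ w) n = s] `|` [set w | pattern (X ^~ w) n \in l].
  apply/seteqP; split => w /=; rewrite inE.
    by move=> /orP[/eqP|]; [left|right].
  by move=> [->|->]; rewrite ?eqxx ?orbT.
split; first exact: measurableU.
apply: le_trans (measureU2 _ m2 m1) _.
rewrite -[(size l).+1%:R]natr1 mulrDl addrC EFinD mul1r -exprVn.
apply: leeD; first by rewrite exprVn; exact: P1.
by rewrite -P2; exact: lexx.
Qed.

(** The event depends on the first [n] coins only, so it is a finite union of words and Chebyshev's
    inequality becomes counting. At most [K * N] increments of square order [1/N^2] give a bound of
    order [1/N]. *)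
Lemma noise_tail (X : nat -> Om -> R) n (eta : R) : fair_coins X ->
  (n <= K * N)%N -> 0 < eta ->
  let A := [set w | eta < `|noise tau mu N (X ^~ w) n|] in
  measurable A /\
  (P A <= ((K%:R * (expR K%:R * (1 + expR K%:R)) ^+ 2 / eta ^+ 2) / N%:R)%:E)%E.
Proof.
move=> fX nK eta0.
pose l := [seq s <- patterns n | eta < `|noise tau mu N (coin_of s) n|].
have -> : [set w | eta < `|noise tau mu N (X ^~ w) n|] =
    [set w | pattern (X ^~ w) n \in l].
  have h w : noise tau mu N (X ^~ w) n =
             noise tau mu N (coin_of (pattern (X ^~ w) n)) n.
    by apply: noise_ext => m mn; rewrite coin_of_pattern.
  apply/seteqP; split => w /=; rewrite mem_filter mem_patterns size_mkseq eqxx andbT;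
    by rewrite -h.
have al : all (fun s => size s == n) l.
  by apply/allP => s; rewrite mem_filter mem_patterns => /andP[].
have [mA PA] := fair_coins_seq fX al; split=> //.
apply: le_trans PA _; rewrite lee_fin.
have Np : 0 < N%:R :> R by rewrite ltr0n.
have p0 : 0 < 2 ^+ n :> R by rewrite exprn_gt0.
have e2 : 0 < eta ^+ 2 by rewrite exprn_gt0.
have cheb : (size l)%:R * eta ^+ 2 <= 2 ^+ n * (n%:R * noise_step ^+ 2).
  apply: le_trans (noise_second_moment nK).
  rewrite mulrC -sum_const_seq.
  rewrite big_filter big_mkcond /=; apply: ler_sum => s _.
  case: ifP => [h|_]; last exact: sqr_ge0.
  by rewrite -(real_normK (num_real (noise _ _ _ _ _))) lerXn2r// ?nnegrE ?(ltW eta0)// ltW.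
rewrite ler_pdivrMr//.
have -> : K%:R * (expR K%:R * (1 + expR K%:R)) ^+ 2 / eta ^+ 2 / N%:R * 2 ^+ n =
   (2 ^+ n * ((K * N)%:R * noise_step ^+ 2)) / eta ^+ 2.
  by rewrite natrM /noise_step; field; rewrite !gt_eqF.
rewrite ler_pdivlMr// (le_trans cheb)// ler_pM2l// ler_wpM2r ?sqr_ge0//.
by rewrite ler_nat.
Qed.

End coins.

(** The number of grid points depends on [K] and [p] but not on [N], while neighbours are about
    [N / p] apart. The right neighbour [j.+1] serves the monotone sandwich for the jump times. *)
Lemma grid_cover (K N p n : nat) : (0 < p)%N -> (0 < N)%N -> (n <= K * N)%N ->
  exists j, [/\ (j <= K * p)%N, (j * N %/ p <= n)%N, (n <= j.+1 * N %/ p)%N,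
    ((n - j * N %/ p) * p < N + p)%N & ((j.+1 * N %/ p - n) * p <= N)%N].
Proof.
move=> p0 N0 nK; exists (n * p %/ N)%N.
have h1 := leq_divM (n * p) N.
have h2 : (n * p < (n * p %/ N).+1 * N)%N by rewrite ltn_ceil.
set j := (n * p %/ N)%N in h1 h2 *.
have h3 := leq_divM (j * N) p.
have h4 : (j * N < (j * N %/ p).+1 * p)%N by rewrite ltn_ceil.
have h5 := leq_divM (j.+1 * N) p.
have h6 : (j.+1 * N < (j.+1 * N %/ p).+1 * p)%N by rewrite ltn_ceil.
set g := (j * N %/ p)%N in h3 h4 *; set g' := (j.+1 * N %/ p)%N in h5 h6 *.
split.
- rewrite -(leq_pmul2r N0) (leq_trans h1)//.
  by rewrite -mulnA [(p * N)%N]mulnC mulnA leq_mul2r nK orbT.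
- by rewrite -(leq_pmul2r p0) (leq_trans h3).
- by rewrite -ltnS -(ltn_pmul2r p0) (ltn_trans h2).
- by rewrite mulnBl; move: h1 h2 h3 h4; rewrite !mulSn; lia.
- by rewrite mulnBl; move: h1 h2 h5 h6; rewrite !mulSn; lia.
Qed.

Lemma union_bound {R : realType} {d} {Om : measurableType d}
    (P : probability Om R) (A : nat -> set Om) (m : nat) (x : R) :
  (forall j, (j < m)%N -> measurable (A j) /\ (P (A j) <= x%:E)%E) ->
  measurable (\bigcup_(j in `I_m) A j) /\
  (P (\bigcup_(j in `I_m) A j) <= (m%:R * x)%:E)%E.
Proof.
move=> mA; rewrite bigcup_mkord; split.
  by apply: bigsetU_measurable => j _; have [] := mA _ (ltn_ord j).
apply: le_trans (Boole_inequality _ _) _.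
  by move=> j /mA[].
apply: (@le_trans _ _ (\sum_(j < m) x%:E)%E).
  by apply: lee_sum => j _; have [] := mA _ (ltn_ord j).
by rewrite sumEFin sumr_const card_ord mulr_natl.
Qed.

Lemma natr_ge_ex {R : realType} (x : R) : exists n : nat, x <= n%:R.
Proof.
exists (Num.truncn `|x|).+1; rewrite (le_trans (ler_norm x))// ltW//.
by have /andP[] := truncn_itv (normr_ge0 x).
Qed.

Lemma noise_uniform {R : realType} {d} {Om : measurableType d}
    (P : probability Om R) (tau mu : R) (K : nat) (delta : R) :
  0 < mu < 1 -> 0 < delta ->
  exists (A : R) (N0 : nat), forall N, (N0 <= N)%N -> (0 < N)%N ->
  forall X : nat -> Om -> R, fair_coins P X ->
  exists B : set Om, [/\ measurable B, (P B <= (A / N%:R)%:E)%E &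
    forall w, ~ B w -> forall n, (n <= K * N)%N ->
      `|noise tau mu N (X ^~ w) n| <= delta].
Proof.
move=> /andP[mu0 mu1] d0.
pose c : R := expR K%:R * (1 + expR K%:R).
have c0 : 0 <= c by rewrite mulr_ge0 ?addr_ge0 ?expR_ge0.
(* This makes the oscillation [2 * c / p] inside a grid cell at most [delta / 2]. Taking [N >= p]
   bounds the cell length [N / p + 1] by [2 * N / p]. *)
have [p hp] := natr_ge_ex (4 * c / delta + 1).
have p0 : 0 < p%:R :> R.
  by apply: lt_le_trans hp; rewrite ltr_wpDl// divr_ge0 ?mulr_ge0// ltW.
have pd : 4 * c <= delta * p%:R by rewrite [delta * _]mulrC -ler_pdivrMr//; lra.
pose A := K%:R * c ^+ 2 / (delta / 2) ^+ 2.
exists ((K * p).+1%:R * A), p => N pN N0 X fX.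
have Np : 0 < N%:R :> R by rewrite ltr0n.
(* Between two grid points [j * N %/ p] the noise moves by at most [2 * c / p]. *)
pose F j := [set w | delta / 2 < `|noise tau mu N (X ^~ w) (j * N %/ p)|].
have p0' : (0 < p)%N by rewrite -(ltr0n R).
have gK j : (j <= K * p)%N -> (j * N %/ p <= K * N)%N.
  move=> jK; rewrite -(leq_pmul2r p0') (leq_trans (leq_divM _ _))//.
  by rewrite -mulnA [(N * p)%N]mulnC mulnA leq_mul2r jK orbT.
have [mF PF] : measurable (\bigcup_(j in `I_(K * p).+1) F j) /\
    (P (\bigcup_(j in `I_(K * p).+1) F j) <= ((K * p).+1%:R * (A / N%:R))%:E)%E.
  apply: union_bound => j jK.
  by apply: noise_tail => //; [exact: gK|exact: divr_gt0].
exists (\bigcup_(j in `I_(K * p).+1) F j); split=> //.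
  by rewrite -mulrA.
move=> w nF n nK.
have [j [jK jn _ nj _]] := grid_cover p0' N0 nK.
set g := (j * N %/ p)%N in jn nj.
have h1 : `|noise tau mu N (X ^~ w) g| <= delta / 2.
  by rewrite leNgt; apply/negP => h; apply: nF; exists j.
have h2 : `|noise tau mu N (X ^~ w) (g + (n - g)) - noise tau mu N (X ^~ w) g| <=
    (n - g)%:R * @noise_step R N K.
  by apply: noise_lipschitz => //; rewrite subnKC.
rewrite subnKC// in h2.
have h3 : (n - g)%:R * @noise_step R N K <= delta / 2.
  rewrite /noise_step -/c mulrA ler_pdivrMr//.
  have h4 : (n - g)%:R * p%:R <= 2 * N%:R :> R.
    by rewrite -!natrM ler_nat mul2n -addnn (leq_trans (ltnW nj))// leq_add2l.
  rewrite -(ler_pM2r p0).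
  have -> : (n - g)%:R * c * p%:R = c * ((n - g)%:R * p%:R) by ring.
  apply: le_trans (ler_wpM2l c0 h4) _.
  have -> : delta / 2 * N%:R * p%:R = 2^-1 * N%:R * (delta * p%:R) by field.
  have -> : c * (2 * N%:R) = 2^-1 * N%:R * (4 * c) by field.
  by rewrite ler_wpM2l// mulr_ge0.
have := ler_normD (noise tau mu N (X ^~ w) n - noise tau mu N (X ^~ w) g)
                  (noise tau mu N (X ^~ w) g).
by rewrite subrK => h5; lra.
Qed.

Lemma indep_fair_coins {R : realType} {d} {Om : measurableType d}
    (P : probability Om R) (Z : nat + nat -> Om -> R) :
  (forall i, measurable_fun setT (Z i)) -> mutual_indep P Z ->
  (forall n, P [set w | Z (inl n) w = 1] = (2^-1)%:E) ->
  fair_coins P (fun n => Z (inl n)).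
Proof.
move=> mZ iZ half s A.
(* The letter [false] stands for the complement of [1], in accordance with [pattern]; its
   probability is [1/2] by complementation. *)
pose E (i : nat + nat) : set R := if i is inl m then
  (if nth false s m then [set 1] else ~` [set 1]) else setT.
have mE i : measurable (E i).
  case: i => [m|m] /=; last exact: measurableT.
  by case: ifP => _; [|apply: measurableC]; exact: measurable_set1.
have mZE i : measurable (Z i @^-1` E i).
  by rewrite -[X in measurable X]setTI; exact: mZ.
have us : uniq (map (inl : nat -> nat + nat) (iota 0 (size s))).
  by rewrite map_inj_uniq ?iota_uniq// => ? ? [].
have AE : A = \bigcap_(i in [set` map (inl : nat -> nat + nat) (iota 0 (size s))])
    (Z i @^-1` E i).
  apply/seteqP; split => w /=.
    move=> ws i /mapP[m]; rewrite mem_iota => /andP[_ ms] -> /=.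
    rewrite add0n in ms.
    have := congr1 (fun t => nth false t m) ws; rewrite nth_mkseq// => <-.
    by case: eqP.
  move=> h; apply: (@eq_from_nth _ false); rewrite size_mkseq// => m ms.
  rewrite nth_mkseq//.
  have mem : (inl m : nat + nat) \in map inl (iota 0 (size s)).
    by apply: map_f; rewrite mem_iota.
  move: (h _ mem) => /=; case: (nth false s m) => /=; first by move=> ->; rewrite eqxx.
  by move=> /eqP/negbTE.
split; first by rewrite AE; apply: fin_bigcap_measurable => // i _.
rewrite AE iZ// big_map.
have Ph m : P (Z (inl m) @^-1` E (inl m)) = (2^-1)%:E.
  rewrite /=; case: ifP => _; first exact: half.
  rewrite -preimage_setC probability_setC; last first.
    by rewrite -[X in measurable X]setTI; exact: mZ.
  by rewrite half -EFinB; congr (_%:E); lra.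
rewrite (eq_bigr (fun=> (2^-1)%:E)) => [|m _]; last exact: Ph.
rewrite -[in RHS](size_iota 0 (size s)); elim: (iota 0 (size s)) => [|m l IH].
  by rewrite big_nil expr0.
by rewrite big_cons IH /= exprS EFinM.
Qed.

(** * The jump times *)

Section indicator_sums.
Context {R : realType} {d} {Om : measurableType d} (P : probability Om R).

Definition pr (A : set Om) : R := fine (P A).

Lemma prE A : measurable A -> P A = (pr A)%:E.
Proof. by move=> mA; rewrite /pr fineK// fin_num_measure. Qed.

Lemma integral_indic_sum (I : Type) (l : seq I) (a : I -> R) (E : I -> set Om) :
  (forall i, measurable (E i)) ->
  let f w := \sum_(i <- l) a i * \1_(E i) w in
  P.-integrable setT (EFin \o f) /\
  (\int[P]_w (f w)%:E = (\sum_(i <- l) a i * pr (E i))%:E)%E.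
Proof.
move=> mE; elim: l => [|i l [IH1 IH2]] f.
  have fE : EFin \o f = cst 0%E by apply/funext => w; rewrite /f /= big_nil.
  split; first by rewrite fE; exact: integrable0.
  by rewrite [X in integral _ _ X](_ : _ = cst 0%E) ?integral0 ?big_nil// -fE.
have fE : EFin \o f = (fun w => (a i)%:E * (\1_(E i) w)%:E)%E
  \+ (EFin \o (fun w => \sum_(i <- l) a i * \1_(E i) w)).
  by apply/funext => w; rewrite /f /= big_cons EFinD EFinM.
have i1 : P.-integrable setT (fun w => (\1_(E i) w)%:E) by exact: integrable_indic.
have i2 := integrableZl measurableT (a i) i1.
split; first by rewrite fE; apply: integrableD.
rewrite [X in integral _ _ X](_ : _ = EFin \o f)// fE integralD//.
rewrite integralZl// integral_indic// setIT.
by rewrite big_cons EFinD IH2 EFinM -prE.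
Qed.

(** The square of the centred count is a finite linear combination of indicators, so its integral
    needs only the probabilities of the events and of their pairwise intersections. *)
Lemma event_chebyshev (I : finType) (A : I -> set Om) (eps : R) :
  (forall i, measurable (A i)) -> 0 < eps ->
  let p := \sum_i pr (A i) in
  let B := [set w | eps <= `|\sum_i \1_(A i) w - p|] in
  measurable B /\
  (P B <= ((\sum_i \sum_j pr (A i `&` A j) - p ^+ 2) / eps ^+ 2)%:E)%E.
Proof.
move=> mA eps0 p B.
(* The three summands of the index type carry the three terms of the expanded square: pairs, the
   cross term, and the constant [p ^+ 2]. *)
pose a (x : (I * I) + (I + unit)) : R :=
  match x with inl _ => 1 | inr (inl _) => - 2 * p | inr (inr _) => p ^+ 2 end.
pose E (x : (I * I) + (I + unit)) : set Om :=
  match x with inl y => A y.1 `&` A y.2 | inr (inl i) => A i | inr (inr _) => setT end.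
have mE x : measurable (E x).
  by case: x => [[i j]|[i|[]]] /=; [exact: measurableI|exact: mA|exact: measurableT].
have [intf intE] := integral_indic_sum (index_enum _) a mE.
set f := (fun w => _) in intf intE.
have fE w : f w = (\sum_i \1_(A i) w - p) ^+ 2.
  rewrite /f big_sumType big_sumType /= [X in _ + (_ + X)](big_pred1 tt); last by case.
  rewrite /= indicT mulr1 -!mulr_sumr mul1r.
  have -> : \sum_(i : I * I) \1_(A i.1 `&` A i.2) w =
      (\sum_i \1_(A i) w) * (\sum_i \1_(A i) w) :> R.
    rewrite big_distrlr /= pair_big /=; apply: eq_bigr => -[i j] _ /=.
    by rewrite indicI.
  by ring.
have fS : \sum_(x <- index_enum _) a x * pr (E x) =
    \sum_i \sum_j pr (A i `&` A j) - p ^+ 2.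
  rewrite big_sumType big_sumType /= [X in _ + (_ + X)](big_pred1 tt); last by case.
  have -> : pr setT = 1 by rewrite /pr probability_setT.
  rewrite -!mulr_sumr mul1r -/p pair_big /=.
  by ring.
rewrite fS in intE.
have mf : measurable_fun setT f.
  by have := measurable_int _ intf; move/measurable_EFinP.
have e2 : 0 < eps ^+ 2 by rewrite exprn_gt0.
have BE : B = [set w | eps ^+ 2 <= f w].
  apply/seteqP; split => w /=; rewrite fE -[X in _ <= X](real_normK (num_real _)).
    by move=> h; rewrite lerXn2r ?nnegrE// ltW.
  by rewrite ler_pXn2r ?nnegrE// ltW.
have mB : measurable B.
  rewrite BE -[X in measurable X]setTI.
  exact: (measurable_fun_le measurableT (measurable_cst _) mf).
split=> //.
have [ing ge] := @integral_indic_sum unit [:: tt] (fun=> eps ^+ 2) (fun=> B) (fun=> mB).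
have h : ((eps ^+ 2 * pr B)%:E <= (\sum_i \sum_j pr (A i `&` A j) - p ^+ 2)%:E)%E.
  rewrite -intE; rewrite big_seq1 in ge; rewrite -ge.
  apply: le_integral => // w _; rewrite lee_fin big_seq1 indicE -/(f w).
  have [|_] := boolP (w \in B); last by rewrite mulr0 fE sqr_ge0.
  by rewrite inE BE /= mulr1.
by rewrite prE// lee_fin ler_pdivlMr// mulrC.
Qed.

End indicator_sums.

Lemma geometric_sum {R : comPzRingType} (r : R) n :
  (1 - r) * \sum_(k < n) r ^+ k = 1 - r ^+ n.
Proof.
elim: n => [|n IH]; first by rewrite big_ord0 mulr0 expr0 subrr.
by rewrite big_ord_recr /= mulrDr IH exprS; ring.
Qed.

(** The sum is the ceiling of [x / h], capped at [n]. The induction also carries the bound of the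
    count by [n]: it yields [h * c <= n * h < x] when a new level is counted. *)
Lemma ceil_count {R : realType} (x h : R) n : 0 < h -> 0 < x ->
  Num.min x (n%:R * h) <= h * \sum_(k < n) (k%:R * h < x)%R%:R <= x + h.
Proof.
move=> h0 x0; set c := \sum_(k < n) _.
suff [] : Num.min x (n%:R * h) <= h * c /\ h * c <= x + h /\ c <= n%:R.
  by move=> -> [-> _].
rewrite {}/c; elim: n => [|n [IH1 [IH2 IH3]]].
  rewrite big_ord0 mulr0 mul0r; split; last by split => //; lra.
  by rewrite ge_min lexx orbT.
rewrite big_ord_recr /= -natr1 mulrDl mul1r.
set c := \sum_(_ < n) _ in IH1 IH2 IH3 *.
have h1 : h * c <= n%:R * h by rewrite mulrC ler_wpM2r// ltW.
case: ltP => nx; rewrite /= ?mulr1n ?mulr0n ?addr0 ?mulrDr ?mulr1.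
  split; last by split; [lra|rewrite lerD2r].
  by rewrite ge_min; apply/orP; right; move: IH1; rewrite min_r ?(ltW nx)//; lra.
split; last by split => //; lra.
by rewrite ge_min; apply/orP; left; move: IH1; rewrite min_l.
Qed.

Section clocks.
Context {R : realType} {d : measure_display} {Om : measurableType d}.
Variable P : probability Om R.

(** Tails and pairwise independence of tail events are the form in which a second moment computation
    takes the law of the holding times. *)
Definition exponential_clocks (s : nat -> Om -> R) :=
  [/\ forall i, measurable_fun setT (s i),
      forall i (x : R), 0 <= x -> P [set w | x < s i w] = (expR (- x))%:E &
      forall i j (x y : R), i != j ->
        P ([set w | x < s i w] `&` [set w | y < s j w]) =
        (P [set w | (x < s i w)%R] * P [set w | (y < s j w)%R])%E].

Lemma measurable_gt (f : Om -> R) (x : R) :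
  measurable_fun setT f -> measurable [set w | x < f w].
Proof.
move=> mf; have -> : [set w | x < f w] = setT `&` f @^-1` `]x, +oo[.
  by rewrite setTI; apply/seteqP; split => w /=; rewrite in_itv /= andbT.
by apply: mf => //; exact: measurable_itv.
Qed.

Lemma pr_le (A B : set Om) : measurable A -> measurable B -> A `<=` B ->
  pr P A <= pr P B.
Proof.
by move=> mA mB AB; rewrite -lee_fin -!prE//; apply: le_measure; rewrite ?inE.
Qed.

(* Counts of distinct clocks are independent, and for one clock
   [P (k h < s, l h < s) = q ^ max(k, l) <= r ^ k * r ^ l] with [q = r ^ 2]; this
   bounds the variance uniformly in the number [N] of levels. *)
Lemma count_tail (s : nat -> Om -> R) (h eps : R) (n N : nat) :
  exponential_clocks s -> 0 < h -> 0 < eps ->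
  let S : R := \sum_(k < N) expR (- h) ^+ k in
  let B := [set w | eps <=
    `|\sum_(i < n) \sum_(k < N) (k%:R * h < s i w)%R%:R - n%:R * S| ] in
  measurable B /\
  (P B <= (n%:R * (1 - expR (- (h / 2))) ^- 2 / eps ^+ 2)%:E)%E.
Proof.
move=> [ms es ind] h0 eps0 S B.
pose A (x : 'I_n * 'I_N) : set Om := [set w | x.2%:R * h < s x.1 w].
have mA x : measurable (A x) by exact: measurable_gt.
have kh0 (k : nat) : 0 <= k%:R * h by rewrite mulr_ge0// ltW.
pose q := expR (- h).
have prA x : pr P (A x) = q ^+ x.2.
  by rewrite /pr es// /q -expRM_natl mulrN.
pose r : R := expR (- (h / 2)).
have r0 : 0 <= r by exact: expR_ge0.
have r1 : r < 1 by rewrite /r expR_lt1 oppr_lt0 divr_gt0.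
have qr : q = r ^+ 2 by rewrite /q /r -expRM_natl; congr expR; field.
have [mB PB] := event_chebyshev P mA eps0.
have pE : \sum_x pr P (A x) = n%:R * S.
  rewrite (eq_bigr (fun x : 'I_n * 'I_N => q ^+ x.2)) => [|x _]; last exact: prA.
  rewrite -(pair_bigA _ (fun (i : 'I_n) (k : 'I_N) => q ^+ k)) /=.
  by rewrite sumr_const card_ord mulr_natl.
have -> : B = [set w | eps <= `|\sum_x \1_(A x) w - \sum_x pr P (A x)|].
  have cE w : \sum_x \1_(A x) w =
      \sum_(i < n) \sum_(k < N) (k%:R * h < s i w)%R%:R :> R.
    rewrite (pair_bigA _ (fun (i : 'I_n) (k : 'I_N) => (k%:R * h < s i w)%R%:R)) /=.
    apply: eq_bigr => x _; rewrite indicE; congr ((nat_of_bool _)%:R).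
    by apply/idP/idP; rewrite inE.
  by apply/seteqP; split => w /=; rewrite pE cE.
split=> //; apply: le_trans PB _; rewrite lee_fin ler_pM2r ?invr_gt0 ?exprn_gt0//.
rewrite lerBlDr.
have pair x y : pr P (A x `&` A y) <=
    (x.1 == y.1)%:R * (r ^+ x.2 * r ^+ y.2) + q ^+ x.2 * q ^+ y.2.
  have q0 : 0 <= q ^+ x.2 * q ^+ y.2 by rewrite mulr_ge0 ?exprn_ge0 ?expR_ge0.
  case: eqP => [xy|/eqP xy]; last first.
    rewrite mul0r add0r /pr ind// -!/(A _).
    by rewrite prE// (prE P (mA y)) /= !prA.
  rewrite mul1r (le_trans _ (_ : r ^+ x.2 * r ^+ y.2 <= _)) ?lerDl//.
  rewrite -exprD; have [xy2|xy2] := leqP x.2 y.2.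
    apply: (@le_trans _ _ (pr P (A y))).
      by apply: pr_le => //; exact: measurableI.
    by rewrite prA qr -exprM ler_wiXn2l ?(ltW r1)//; lia.
  apply: (@le_trans _ _ (pr P (A x))).
    by apply: pr_le => //; exact: measurableI.
  by rewrite prA qr -exprM ler_wiXn2l ?(ltW r1)//; lia.
apply: (@le_trans _ _ (\sum_(x : 'I_n * 'I_N) \sum_(y : 'I_n * 'I_N)
  ((x.1 == y.1)%:R * (r ^+ x.2 * r ^+ y.2) + q ^+ x.2 * q ^+ y.2))).
  by apply: ler_sum => x _; apply: ler_sum => y _; exact: pair.
under eq_bigr do rewrite big_split /=.
rewrite big_split /= lerD//; last first.
  under eq_bigr do rewrite -mulr_sumr.
  rewrite -mulr_suml; have -> : \sum_x pr P (A x) = \sum_(x : 'I_n * 'I_N) q ^+ x.2.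
    by apply: eq_bigr => x _; rewrite prA.
  by rewrite expr2.
have -> : \sum_(x : 'I_n * 'I_N) \sum_(y : 'I_n * 'I_N)
    ((x.1 == y.1)%:R * (r ^+ x.2 * r ^+ y.2)) = n%:R * (\sum_(k < N) r ^+ k) ^+ 2.
  rewrite -(pair_bigA _ (fun (i : 'I_n) (k : 'I_N) => \sum_(y : 'I_n * 'I_N)
    ((i == y.1)%:R * (r ^+ k * r ^+ y.2)))) /=.
  rewrite (eq_bigr (fun=> (\sum_(k < N) r ^+ k) ^+ 2)) => [|i _].
    by rewrite sumr_const card_ord mulr_natl.
  rewrite expr2 mulr_suml; apply: eq_bigr => k _.
  rewrite -(pair_bigA _ (fun (j : 'I_n) (l : 'I_N) =>
    (i == j)%:R * (r ^+ k * r ^+ l))) /= (bigD1 i)//= [X in _ + X]big1 => [|j ji].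
    by rewrite addr0 mulr_sumr; apply: eq_bigr => l _; rewrite eqxx mul1r.
  by apply: big1 => l _; rewrite eq_sym (negbTE ji) mul0r.
rewrite ler_wpM2l// -exprVn lerXn2r ?nnegrE ?invr_ge0 ?subr_ge0 ?(ltW r1)//.
  by apply: sumr_ge0 => k _; exact: exprn_ge0.
rewrite -[X in _ <= X]mul1r ler_pdivlMr ?subr_gt0// mulrC geometric_sum.
by rewrite gerBl exprn_ge0.
Qed.

End clocks.

(** The three errors are the fluctuation of the count, the rounding up to multiples of [h], and the
    missing tail of the geometric series. The mean is right because [h / (1 - q)] lies between [1]
    and [1 + h]. *)
Lemma jump_time_count {R : realType} (sigma : nat -> R) (h eps : R) (n N : nat) :
  0 < h -> (forall i, (i < n)%N -> 0 < sigma i <= N%:R * h) ->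
  let S : R := \sum_(k < N) expR (- h) ^+ k in
  `|\sum_(i < n) \sum_(k < N) (k%:R * h < sigma i)%R%:R - n%:R * S| <= eps ->
  `|jump_time sigma n - n%:R| <= h * eps + n%:R * h + n%:R * expR (- h) ^+ N.
Proof.
move=> h0 s0 S.
set C := \sum_(i < n) _ => CS.
set q := expR (- h) in S CS *.
have hC : jump_time sigma n <= h * C <= jump_time sigma n + n%:R * h.
  rewrite /C mulr_sumr /jump_time; apply/andP; split.
    apply: ler_sum => i _; have /andP[i0 iN] := s0 i (ltn_ord i).
    by have /andP[+ _] := ceil_count N h0 i0; rewrite min_l.
  have -> : n%:R * h = \sum_(i < n) h by rewrite sumr_const card_ord mulr_natl.
  rewrite -big_split /=; apply: ler_sum => i _.
  have /andP[i0 iN] := s0 i (ltn_ord i).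
  by have /andP[_ +] := ceil_count N h0 i0.
have q0 : 0 < q by exact: expR_gt0.
have q1 : q < 1 by rewrite /q expR_lt1 oppr_lt0.
have gS : (1 - q) * S = 1 - q ^+ N by exact: geometric_sum.
have S0 : 0 <= S by apply: sumr_ge0 => k _; rewrite exprn_ge0// ltW.
have qN : 0 <= q ^+ N by rewrite exprn_ge0// ltW.
have hS1 : 1 - q ^+ N <= h * S.
  rewrite -gS ler_wpM2r//; have := expR_ge1Dx (- h); rewrite -/q; lra.
have hS2 : h * S <= 1 + h.
  have h1 : (1 + h) * q <= 1.
    apply: (@le_trans _ _ (expR h * q)).
      by rewrite ler_pM2r// expR_ge1Dx.
    by rewrite /q expRN divff// gt_eqF// expR_gt0.
  have h2 : h * S <= (1 + h) * (1 - q) * S by rewrite ler_wpM2r//; lra.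
  apply: le_trans h2 _; rewrite -mulrA gS.
  by rewrite ler_piMr//; lra.
have n0 : 0 <= n%:R :> R by [].
have nS1 := ler_wpM2l n0 hS1; have nS2 := ler_wpM2l n0 hS2.
have hCS : - (h * eps) <= h * C - n%:R * (h * S) <= h * eps.
  have -> : h * C - n%:R * (h * S) = h * (C - n%:R * S) by ring.
  move: CS; rewrite ler_norml => /andP[c1 c2].
  by rewrite -mulrN !ler_wpM2l// ltW.
move: hC hCS => /andP[a1 a2] /andP[b1 b2].
have nh : 0 <= n%:R * h by rewrite mulr_ge0// ltW.
have nq : 0 <= n%:R * q ^+ N by rewrite mulr_ge0.
by rewrite ler_norml; apply/andP; split; lra.
Qed.

(** Quadratic decay suffices: a union over order [N] clocks, each exceeding [N * h] with probability
    of order [1/N^2], still has probability of order [1/N]. *)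
Lemma expRN_le {R : realType} (x : R) : 0 < x -> expR (- x) <= 4 / x ^+ 2.
Proof.
move=> x0; have h : (x / 2) ^+ 2 <= expR x.
  have -> : expR x = expR (x / 2) ^+ 2.
    by rewrite -expRM_natl; congr expR; field.
  rewrite lerXn2r ?nnegrE ?expR_ge0 ?divr_ge0 ?(ltW x0)//.
  by apply: le_trans (expR_ge1Dx _); rewrite lerDr.
rewrite expRN -[4 / _]invrK lef_pV2 ?posrE ?expR_gt0 ?invr_gt0 ?divr_gt0 ?exprn_gt0//.
by apply: le_trans h; rewrite invf_div le_eqVlt; apply/orP; left; apply/eqP; field.
Qed.

Lemma jump_uniform {R : realType} {d} {Om : measurableType d}
    (P : probability Om R) (K : nat) (delta : R) : 0 < delta ->
  exists (A : R) (N0 : nat), forall N, (N0 <= N)%N -> (0 < N)%N ->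
  forall s : nat -> Om -> R, exponential_clocks P s ->
  exists B : set Om, [/\ measurable B, (P B <= (A / N%:R)%:E)%E &
    forall w, ~ B w -> (forall i, 0 < s i w) /\
      forall n, (n <= K * N)%N ->
        `|jump_time (s ^~ w) n - n%:R| <= delta * N%:R].
Proof.
move=> d0.
(* The grid reaches one point further than [K * N], since the right neighbour of the last cell is
   used too; [K.+1] leaves room for it. *)
pose K1 := K.+1; have K10 : 0 < K1%:R :> R by rewrite ltr0n.
(* [h], [e] and [N1] are tuned so that each of the three errors of [jump_time_count] is at most
   [delta / 8 * N]. *)
pose h : R := delta / (8 * K1%:R).
have h0 : 0 < h by rewrite divr_gt0// mulr_gt0.
have hK : K1%:R * h = delta / 8 by rewrite /h; field; rewrite gt_eqF.
clearbody h.
have [p hp] := natr_ge_ex (8 / delta + 1).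
have pd0 : 0 < 8 / delta by rewrite divr_gt0.
have p0 : 0 < p%:R :> R by lra.
have p0' : (0 < p)%N by rewrite -(ltr0n R).
have pd : 8 <= delta * p%:R by rewrite [delta * _]mulrC -ler_pdivrMr//; lra.
have [N1 hN1] := natr_ge_ex (8 * K1%:R / (h * delta)).
pose e : R := delta / (8 * h).
have e0 : 0 < e by rewrite divr_gt0// mulr_gt0.
have he : h * e = delta / 8 by rewrite /e; field; rewrite gt_eqF.
clearbody e.
pose Q : R := (1 - expR (- (h / 2))) ^- 2.
have Q0 : 0 <= Q.
  by rewrite invr_ge0 exprn_ge0// subr_ge0 expR_le1 oppr_le0 divr_ge0// ltW.
pose A3 := K1%:R * Q / e ^+ 2.
pose A2 := K1%:R * (4 / h ^+ 2).
exists (A2 + (K * p).+2%:R * A3), (maxn p N1) => N.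
rewrite geq_max => /andP[pN NN1] N0 s es.
have Np : 0 < N%:R :> R by rewrite ltr0n.
have [ms ts _] := es.
(* The number of levels is [N] itself, so the cap [N * h] grows with [N]; [count_tail] is uniform in
   it. *)
pose S : R := \sum_(k < N) expR (- h) ^+ k.
pose g j := (j * N %/ p)%N.
(* Three ways to be exceptional: a nonpositive clock, which is a null event; a clock above the cap
   [N * h]; a large deviation of the count at a grid point. *)
pose F1 i := [set w | s i w <= 0].
pose F2 i := [set w | N%:R * h < s i w].
pose F3 j := [set w | e * N%:R <=
  `|\sum_(i < g j) \sum_(k < N) (k%:R * h < s i w)%R%:R - (g j)%:R * S| ].
have F1C i : F1 i = ~` [set w | 0 < s i w].
  by apply/seteqP; split => w /=; rewrite /F1 /= leNgt => /negP.
have mF1 i : measurable (F1 i).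
  by rewrite F1C; apply: measurableC; exact: measurable_gt.
have PF1 i : P (F1 i) = 0%E.
  rewrite F1C probability_setC ?ts ?oppr0 ?expR0 ?subee//.
  exact: measurable_gt.
have mU1 : measurable (\bigcup_i F1 i) by exact: bigcup_measurable.
have PU1 : P (\bigcup_i F1 i) = 0%E.
  apply/eqP; rewrite eq_le measure_ge0 andbT.
  apply: le_trans (generalized_Boole_inequality P _ _) _ => //.
  by rewrite eseries0// => i _ _; exact: PF1.
have [mU2 PU2] : measurable (\bigcup_(i in `I_(K1 * N)) F2 i) /\
    (P (\bigcup_(i in `I_(K1 * N)) F2 i) <=
     ((K1 * N)%:R * (4 / (N%:R * h) ^+ 2))%:E)%E.
  apply: union_bound => i _; split; first exact: measurable_gt.
  rewrite /F2 ts; last by rewrite mulr_ge0// ltW.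
  by rewrite lee_fin expRN_le// mulr_gt0.
have gK j : (j <= (K * p).+1)%N -> (g j <= K1 * N)%N.
  move=> jK; rewrite -(leq_pmul2r p0') (leq_trans (leq_divM _ _))//.
  rewrite /K1 -mulnA [(N * p)%N]mulnC mulnA leq_mul2r; apply/orP; right.
  by apply: (leq_trans jK); rewrite mulSn addnC -addn1 leq_add2l.
have [mU3 PU3] : measurable (\bigcup_(j in `I_(K * p).+2) F3 j) /\
    (P (\bigcup_(j in `I_(K * p).+2) F3 j) <= ((K * p).+2%:R * (A3 / N%:R))%:E)%E.
  apply: union_bound => j jK.
  have eN := mulr_gt0 e0 Np; have [mB PB] := count_tail (g j) N es h0 eN.
  split=> //; apply: le_trans PB _; rewrite lee_fin -/Q.
  have -> : A3 / N%:R = (K1 * N)%:R * Q / (e * N%:R) ^+ 2.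
    by rewrite /A3 natrM; field; rewrite (gt_eqF Np) (gt_eqF e0).
  rewrite ler_pM2r ?invr_gt0 ?exprn_gt0//.
  by rewrite ler_wpM2r// ler_nat gK.
have mU23 := measurableU _ _ mU2 mU3.
exists ((\bigcup_i F1 i) `|` ((\bigcup_(i in `I_(K1 * N)) F2 i) `|`
        (\bigcup_(j in `I_(K * p).+2) F3 j))).
split.
- exact: measurableU.
- apply: le_trans (measureU2 P mU1 mU23) _.
  rewrite [X in (X + _ <= _)%E](_ : _ = 0%E) ?add0e; last exact: PU1.
  apply: le_trans (measureU2 P mU2 mU3) _.
  rewrite mulrDl EFinD; apply: leeD.
    apply: le_trans PU2 _; rewrite lee_fin natrM /A2.
    by rewrite le_eqVlt; apply/orP; left; apply/eqP; field; rewrite !gt_eqF.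
  by rewrite -mulrA.
move=> w nB.
have s0 i : 0 < s i w.
  by rewrite ltNge; apply/negP => si; apply: nB; left; exists i.
split=> // n nK.
have sN i : (i < K1 * N)%N -> s i w <= N%:R * h.
  by move=> iK; rewrite leNgt; apply/negP => si; apply: nB; right; left; exists i.
have close j : (j <= (K * p).+1)%N ->
    `|jump_time (s ^~ w) (g j) - (g j)%:R| <= 3 / 8 * delta * N%:R.
  move=> jK.
  have h1 : `|\sum_(i < g j) \sum_(k < N) (k%:R * h < s i w)%R%:R - (g j)%:R * S|
      <= e * N%:R.
    rewrite leNgt; apply/negP => si; apply: nB; right; right; exists j => //=.
    exact: ltW.
  have h2 i : (i < g j)%N -> 0 < s i w <= N%:R * h.
    by move=> ij; rewrite s0 sN// (leq_trans ij)// gK.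
  apply: le_trans (jump_time_count h0 h2 h1) _.
  have gN : (g j)%:R <= K1%:R * N%:R :> R by rewrite -natrM ler_nat gK.
  have -> : h * (e * N%:R) = delta / 8 * N%:R by rewrite mulrA he.
  have a1 : (g j)%:R * h <= delta / 8 * N%:R.
    by rewrite -hK mulrAC ler_pM2r.
  have a2 : (g j)%:R * expR (- h) ^+ N <= delta / 8 * N%:R.
    apply: (@le_trans _ _ (K1%:R * N%:R * expR (- h) ^+ N)).
      by rewrite ler_wpM2r// exprn_ge0// expR_ge0.
    rewrite mulrAC ler_pM2r//.
    have hd0 : 0 < h * delta by rewrite mulr_gt0.
    have b1 : 8 * K1%:R <= N%:R * (h * delta).
      by rewrite -ler_pdivrMr// (le_trans hN1)// ler_nat.
    have b2 : expR (- h) ^+ N <= (N%:R * h)^-1.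
      rewrite -expRM_natl mulrN expRN lef_pV2 ?posrE ?expR_gt0 ?mulr_gt0//.
      by apply: le_trans (expR_ge1Dx _); rewrite lerDr.
    apply: le_trans (ler_wpM2l (ltW K10) b2) _.
    by rewrite ler_pdivrMr ?mulr_gt0//; lra.
  by lra.
have [j [jK jn nj j1 j2]] := grid_cover p0' N0 nK.
have jj1 := close j (leqW jK).
have jj2 := close j.+1 jK.
rewrite -/(g j) -/(g j.+1) in jn nj j1 j2.
have d1 : (n - g j)%:R <= delta / 4 * N%:R.
  rewrite -(ler_pM2r p0) -natrM.
  apply: (@le_trans _ _ (2 * N%:R)).
    by rewrite -natrM ler_nat mul2n -addnn (leq_trans (ltnW j1))// leq_add2l.
  have -> : delta / 4 * N%:R * p%:R = 4^-1 * N%:R * (delta * p%:R) by ring.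
  have -> : 2 * N%:R = 4^-1 * N%:R * 8 :> R by field.
  by rewrite ler_wpM2l// mulr_ge0.
have d2 : (g j.+1 - n)%:R <= delta / 4 * N%:R.
  rewrite -(ler_pM2r p0) -natrM.
  apply: (@le_trans _ _ (2 * N%:R)).
    by rewrite -natrM ler_nat mul2n -addnn (leq_trans j2)// leq_addr.
  have -> : delta / 4 * N%:R * p%:R = 4^-1 * N%:R * (delta * p%:R) by ring.
  have -> : 2 * N%:R = 4^-1 * N%:R * 8 :> R by field.
  by rewrite ler_wpM2l// mulr_ge0.
(* Monotonicity squeezes [J_n] between two grid values: the grid error [3/8] and the cell width
   [1/4] add up to less than [1], in units of [delta * N]. *)
have m1 := jump_time_homo s0 jn; have m2 := jump_time_homo s0 nj.
rewrite natrB// in d1; rewrite natrB// in d2.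
move: jj1 jj2; rewrite !ler_norml => /andP[a1 a2] /andP[b1 b2].
have dN : 0 <= delta * N%:R by rewrite mulr_ge0// ltW.
by apply/andP; split; lra.
Qed.

(** * Convergence in probability *)

Lemma sk_dist_le {R : realType} (a b eps : R) (f g : R -> R) :
  0 <= eps -> (forall t, seg a b t -> `|f t - g t| <= eps) ->
  (sk_dist a b f g <= eps%:E)%E.
Proof.
move=> eps0 fg; apply: ereal_inf_le; eexists.
  exists id; split; last reflexivity.
  split=> //; split=> //; split=> //.
  by apply: continuous_subspaceT => x; exact: cvg_id.
rewrite ge_max; apply/andP; split; apply: ge_ereal_sup => _ [t tab <-].
  by rewrite subrr normr0 lee_fin.
by rewrite lee_fin fg.
Qed.

Lemma indep_exponential_clocks {R : realType} {d} {Om : measurableType d}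
    (P : probability Om R) (Z : nat + nat -> Om -> R) :
  (forall i, measurable_fun setT (Z i)) -> mutual_indep P Z ->
  (forall n (x : R), 0 <= x -> P [set w | x < Z (inr n) w] = (expR (- x))%:E) ->
  exponential_clocks P (fun n => Z (inr n)).
Proof.
move=> mZ iZ eZ; split=> // i j x y ij.
(* Only the two indices [inr i] and [inr j] enter the intersection, so the default branch can serve
   [inr j]. *)
pose E (k : nat + nat) : set R :=
  if k == inr i then `]x, +oo[%classic else `]y, +oo[%classic.
have Ei : Z (inr i) @^-1` E (inr i) = [set w | x < Z (inr i) w].
  by rewrite /E eqxx; apply/seteqP; split => w /=; rewrite in_itv /= andbT.
have ji : (inr j == inr i :> nat + nat) = false.
  by apply/negbTE; apply: contra ij => /eqP[->].
have Ej : Z (inr j) @^-1` E (inr j) = [set w | y < Z (inr j) w].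
  by rewrite /E ji; apply/seteqP; split => w /=; rewrite in_itv /= andbT.
have us : uniq [:: inr i; inr j : nat + nat] by rewrite /= inE eq_sym ji.
have mE k : measurable (E k) by rewrite /E; case: ifP => _; exact: measurable_itv.
have := iZ _ E us mE; rewrite !big_cons big_nil mule1 Ei Ej => <-.
congr (P _); apply/seteqP; split => w /=.
  move=> [wi wj].
  have hi : (Z (inr i) @^-1` E (inr i)) w by rewrite Ei.
  have hj : (Z (inr j) @^-1` E (inr j)) w by rewrite Ej.
  by move=> k /=; rewrite !inE => /orP[] /eqP ->.
move=> h; split.
  have : (Z (inr i) @^-1` E (inr i)) w by apply: h; rewrite /= !inE eqxx.
  by rewrite Ei.
have : (Z (inr j) @^-1` E (inr j)) w by apply: h; rewrite /= !inE eqxx orbT.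
by rewrite Ej.
Qed.

Unset Implicit Arguments.

Theorem theorem2p1 (R : realType) (d : measure_display) (Om : measurableType d)
  (P : probability Om R) (tau mu T : R) (Z : nat -> nat + nat -> Om -> R) :
  0 < tau -> 0 < mu < 1 -> 0 < T ->
  (forall N i, measurable_fun setT (Z N i)) ->
  (forall N, mutual_indep P (Z N)) ->
  (forall N n, P [set w | Z N (inl n) w = 1] = (2^-1)%:E /\
               P [set w | Z N (inl n) w = 0] = (2^-1)%:E) ->
  (forall N n (x : R), 0 <= x -> P [set w | x < Z N (inr n) w] = (expR (- x))%:E) ->
  exists u : R -> R,
    hutchinson_sol tau mu T u /\
    (forall v, hutchinson_sol tau mu T v -> forall t, seg (- tau) T t -> v t = u t) /\
    sk_cvg_in_prob P (- tau) T
      (fun N w => rescaled tau mu N.+1 (fun n => Z N.+1 (inl n) w)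
                                       (fun n => Z N.+1 (inr n) w)) u.
Proof.
move=> tau0 mu01 T0 mZ iZ cZ eZ.
have /andP[mu0 mu1] := mu01.
have [K TK] := natr_ge_ex (T + tau + 2).
have [u [cu u0 um du]] := @hutchinson_exists R tau mu K%:R tau0 mu0.
have solu : hutchinson_sol tau mu T u.
  split; first exact: continuous_subspaceT.
  split; first by move=> t /andP[_]; exact: um.
  by move=> t /andP[t0 tT]; apply: du; rewrite t0 /=; lra.
exists u; split=> //; split; first by move=> v; exact: hutchinson_unique.
move=> eps eps0.
have [delta d0 [N0 close]] := rescaled_close tau0 mu01 T0 TK cu um du eps0.
have [A1 [N1 noiseP]] := noise_uniform P tau K mu01 d0.
have [A2 [N2 jumpP]] := jump_uniform P K d0.
pose M := maxn N0 (maxn N1 N2).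
pose bad N := [set w | (eps%:E < sk_dist (- tau) T
  (rescaled tau mu N.+1 (fun n => Z N.+1 (inl n) w) (fun n => Z N.+1 (inr n) w)) u)%E].
(* The bad event is covered by a measurable set, as outer probability requires. For small [N] the
   whole space does; otherwise the exceptional sets of coins and clocks do, with total bound
   [(A1 + A2) / N.+1], which is where [harmonic] comes from. *)
have ex N : exists B : set Om, [/\ measurable B, bad N `<=` B &
    (M <= N)%N -> (P B <= ((A1 + A2) * harmonic N)%:E)%E].
  have [MN|_] := leqP M N; last by exists setT; split.
  have : (M <= N.+1)%N by exact: leqW.
  rewrite !geq_max => /and3P[NN0 NN1 NN2].
  have half n : P [set w | Z N.+1 (inl n) w = 1] = (2^-1)%:E by have [] := cZ N.+1 n.
  have fc := indep_fair_coins (mZ N.+1) (iZ N.+1) half.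
  have ec := indep_exponential_clocks (mZ N.+1) (iZ N.+1) (eZ N.+1).
  have [B1 [mB1 PB1 B1P]] := noiseP _ NN1 (ltn0Sn N) _ fc.
  have [B2 [mB2 PB2 B2P]] := jumpP _ NN2 (ltn0Sn N) _ ec.
  exists (B1 `|` B2); split; first exact: measurableU.
    move=> w /=; apply: contraPP => /not_orP[nB1 nB2].
    have [s0 Js] := B2P _ nB2.
    apply/negP; rewrite -leNgt; apply: sk_dist_le; first exact: ltW.
    by apply: close => //; exact: B1P.
  move=> _; apply: le_trans (measureU2 P mB1 mB2) _.
  by rewrite mulrDl EFinD; exact: leeD.
have [B BP] := choice ex.
exists B; split; first by move=> N; have [] := BP N.
apply: (@squeeze_cvge _ _ _ _ (cst 0%E) _ (fun N => ((A1 + A2) * harmonic N)%:E)).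
- near=> N; rewrite measure_ge0 /=.
  have [_ _] := BP N; apply.
  by near: N; exact: nbhs_infty_ge.
- exact: cvg_cst.
- apply: cvg_EFin; first exact: nearW.
  rewrite -[X in _ --> X](mulr0 (A1 + A2)); apply: cvgM; first exact: cvg_cst.
  exact: cvg_harmonic.
Unshelve. all: by end_near. Qed.
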